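(* Let $E,F\in\mathcal F_{T,\alpha\beta}$. If there is a size-preserving bijection from the collection of horizontal blocks of $E$ to that of $F$, and the $\alpha\beta$-block of $E$ has the same size as the $\alpha\beta$-block of $F$, then $E$ is bi-Hölder equivalent to $F$ (in particular $E$ and $F$ are homeomorphic): there exist a bijection $f:E\to F$, $s>0$ and $C>0$ with $C^{-1}|x-y|^{1/s}\le|f(x)-f(y)|\le C|x-y|^s$ for all $x,y\in E$. If in addition both $E$ and $F$ have uniform contraction ratio $r$ (all $r_j=r$ in both IFSs), then $E$ and $F$ are Lipschitz equivalent, i.e. such an $f$ exists with $s=1$.
   Context: Let $\Delta\subset\mathbb R^2$ be the triangle with vertices $\omega_\alpha=(0,0)$, $\omega_\beta=(1,0)$, $\omega_\gamma=(1/2,\sqrt3/2)$. A fractal gasket is the attractor $K$ of an IFS $\{\varphi_j(z)=r_j(z+d_j)\}_{j=1}^N$ with $r_j\in(0,1)$, $d_j\in\mathbb R^2$, such that $\bigcup_j\varphi_j(\Delta)\subset\Delta$ and for $i\ne j$, $\varphi_i(\Delta)$ and $\varphi_j(\Delta)$ intersect only at common vertices. With $\Sigma=\{1,\dots,N\}$: $\alpha=-1$ if $(0,0)\notin K$, otherwise $\alpha\in\Sigma$ with $\varphi_\alpha((0,0))=(0,0)$; likewise $\beta=-2$ or $\varphi_\beta$ fixes $(1,0)$; $\gamma=-3$ or $\varphi_\gamma$ fixes $\omega_\gamma$. $K$ satisfies the top isolated condition if $\omega_\gamma\in K$ and $\varphi_\gamma(\Delta)\cap\varphi_j(\Delta)=\emptyset$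 for all $j\neq\gamma$. A horizontal block of $K$ is a set $I=\{i_1,\dots,i_k\}\subset\Sigma$ with $\varphi_{i_j}(\omega_\beta)=\varphi_{i_{j+1}}(\omega_\alpha)$ for $1\le j\le k-1$ which is maximal with this property; $k$ is its size. If $\alpha$ and $\beta$ lie in the same horizontal block, this block is the $\alpha\beta$-block. $\mathcal F_{T,\alpha\beta}$ is the collection of fractal gaskets $K$ such that (i) $K$ satisfies the top isolated condition or $\omega_\gamma\notin K$, and (ii) $\alpha$ and $\beta$ belong to the same horizontal block of $K$. *)

(* Defs.v *)
From HB Require Import structures.
From mathcomp Require Import all_boot all_order all_algebra.
From mathcomp Require Import all_classical all_reals all_analysis.
From mathcomp Require Import Rstruct Rstruct_topology.
Set Implicit Arguments. Unset Strict Implicit. Unset Printing Implicit Defensive.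
Import Order.TTheory GRing.Theory Num.Theory.
Local Open Scope classical_set_scope.
Local Open Scope ring_scope.

Notation R := Rdefinitions.R.
Definition pt := (R * R)%type.

Definition dist (p q : pt) : R := Num.sqrt ((p.1 - q.1) ^+ 2 + (p.2 - q.2) ^+ 2).

Definition w_alpha : pt := (0, 0).
Definition w_beta : pt := (1, 0).
Definition w_gamma : pt := (2^-1, Num.sqrt 3 / 2).
Definition vertices : set pt := [set w_alpha; w_beta; w_gamma].

Definition Delta : set pt :=
  [set p | exists a b c : R, [/\ 0 <= a, 0 <= b, 0 <= c, a + b + c = 1 &
      p = (a * w_alpha.1 + b * w_beta.1 + c * w_gamma.1,
           a * w_alpha.2 + b * w_beta.2 + c * w_gamma.2)]].

(* An IFS {phi_j(z) = r_j (z + d_j)}_{j in Sigma}, with Sigma = 'I_N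
   (0-based indices instead of 1..N). *)
Record IFS := { N : nat; ifs_ratio : 'I_N -> R; ifs_shift : 'I_N -> pt }.

Definition phi (S : IFS) (j : 'I_(N S)) (z : pt) : pt :=
  (ifs_ratio j * (z.1 + (ifs_shift j).1), ifs_ratio j * (z.2 + (ifs_shift j).2)).

Definition is_attractor (S : IFS) (K : set pt) : Prop :=
  [/\ K !=set0, compact K & K = \bigcup_(j in [set: 'I_(N S)]) (phi j @` K)].

Definition gasket_IFS (S : IFS) : Prop :=
  [/\ (forall j : 'I_(N S), 0 < ifs_ratio j < 1),
      (forall j : 'I_(N S), phi j @` Delta `<=` Delta) &
      (forall i j : 'I_(N S), i != j -> forall p, (phi i @` Delta) p -> (phi j @` Delta) p ->
          exists v w, [/\ vertices v, vertices w, p = phi i v & p = phi j w])].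

Definition fractal_gasket (S : IFS) (K : set pt) : Prop :=
  gasket_IFS S /\ is_attractor S K.

Definition is_alpha (S : IFS) (K : set pt) (a : 'I_(N S)) : Prop :=
  K w_alpha /\ phi a w_alpha = w_alpha.
Definition is_beta (S : IFS) (K : set pt) (b : 'I_(N S)) : Prop :=
  K w_beta /\ phi b w_beta = w_beta.
Definition is_gamma (S : IFS) (K : set pt) (g : 'I_(N S)) : Prop :=
  K w_gamma /\ phi g w_gamma = w_gamma.

Definition top_isolated (S : IFS) (K : set pt) : Prop :=
  exists g : 'I_(N S), is_gamma K g /\
    forall j : 'I_(N S), j != g -> (phi g @` Delta) `&` (phi j @` Delta) = set0.

Definition hchain (S : IFS) (I : {set 'I_(N S)}) : Prop :=
  exists s : seq 'I_(N S), [/\ s != [::], uniq s, I = [set x in s] &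
    sorted (fun i j => phi i w_beta == phi j w_alpha) s].

Definition hblock (S : IFS) (I : {set 'I_(N S)}) : Prop :=
  hchain I /\ forall J : {set 'I_(N S)}, hchain J -> I \subset J -> I = J.

Definition in_FTab (S : IFS) (K : set pt) : Prop :=
  [/\ fractal_gasket S K,
      top_isolated S K \/ ~ K w_gamma &
      exists (I : {set 'I_(N S)}) (a b : 'I_(N S)), [/\ hblock I, is_alpha K a, is_beta K b, a \in I & b \in I]].

Definition bi_holder_map (E F : set pt) (f : pt -> pt) (s C : R) : Prop :=
  [/\ set_inj E f, f @` E = F, 0 < s, 0 < C &
      forall x y, E x -> E y ->
        C^-1 * powR (dist x y) (s^-1) <= dist (f x) (f y) /\
        dist (f x) (f y) <= C * powR (dist x y) s].

(* Main.v *)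
Require Import Defs.
From HB Require Import structures.
From mathcomp Require Import all_boot all_order all_algebra.
From mathcomp Require Import all_classical all_reals all_analysis.
From mathcomp Require Import Rstruct Rstruct_topology.
From mathcomp Require Import zify ring lra.
Set Implicit Arguments. Unset Strict Implicit. Unset Printing Implicit Defensive.
Import Order.TTheory GRing.Theory Num.Theory numFieldNormedType.Exports.

(** Code the points of a gasket by sequences of letters; up to constants, the
    distance of two points is governed by the last level at which their cells are
    equal or touch.  Hence a correspondence between codes that preserves "the cells
    of level n touch" up to a bounded shift of n gives a bi-Hoelder map, which is
    bi-Lipschitz when all ratios are equal.

    If the tops of the cells touched nothing, any letter bijection respecting the
    horizontal blocks, the order inside them, alpha and beta would do.  So it
    suffices to remove the vertical contacts of one gasket.  Let the top of cell i
    touch the corner s (left or right) of cell j, let l be the letter fixing that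
    corner, g the letter fixing the top, and let i0 be a cell with free top above the
    alpha-beta-block.  By top isolation the cells i g^n and j l^n i0 g are isolated
    apart from the top point of i, which permits a Hilbert hotel:
      i g^(n+3) c -> j l^(n+1) i0 g c  (c <> g),   i g^oo -> j l^oo,
      j l^(n+2) i0 g -> j l^(n+1) i0 g g,          j l i0 g -> i g g g.
    These rewritings preserve lengths and occur in disjoint windows, so all of them,
    at all scales and for all contacts, can be performed simultaneously without
    accumulating distortion. *)

(** * Codes and coarse correspondences *)

Inductive vtx := VA | VB | VG.

Definition sh (T : Type) (k : nat) (a : nat -> T) : nat -> T := fun n => a (k + n)%N.

Section Near.
Local Open Scope nat_scope.
Variables (T P : Type) (V : T -> vtx -> P) (fx : vtx -> T -> Prop).
Implicit Types a b : nat -> T.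

Definition runs n t a := forall k, k < n -> fx t (a k).

(* The cells of level [n] of the codes [a] and [b] are equal or share a vertex:
   [V i t] is the vertex [t] of the cell [i], and [fx t c] says that the map [c]
   fixes the vertex [t], so a run of such letters stays at that vertex.  The
   predicate [ok] selects the vertices at which contacts are taken into account. *)
Fixpoint code_near (ok : vtx -> Prop) n a b : Prop :=
  if n is m.+1 then
    (a 0 = b 0 /\ code_near ok m (sh 1 a) (sh 1 b)) \/
    exists t u, [/\ ok t, ok u, V (a 0) t = V (b 0) u,
                    runs m t (sh 1 a) & runs m u (sh 1 b)]
  else True.

Lemma shD k l a : sh k (sh l a) = sh (l + k) a.
Proof. by apply/funext => n; rewrite /sh addnA. Qed.

Lemma near_agree ok n a b : (forall k, k < n -> a k = b k) -> code_near ok n a b.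
Proof.
elim: n a b => [//|n IH] a b ab; left; split; first exact: ab.
by apply: IH => k kn; apply: ab.
Qed.

Lemma near_sym ok n a b : code_near ok n a b -> code_near ok n b a.
Proof.
elim: n a b => [//|n IH] a b [[ab h]|[t [u [ot ou e ra rb]]]]; [left|right].
  by split => //; apply: IH.
by exists u, t.
Qed.

Lemma runsW m n t a : m <= n -> runs n t a -> runs m t a.
Proof. by move=> mn r k km; apply: r; apply: leq_trans mn. Qed.

Lemma nearW ok m n a b : m <= n -> code_near ok n a b -> code_near ok m a b.
Proof.
elim: n m a b => [|n IH] [|m] a b // mn [[ab h]|[t [u [ot ou e ra rb]]]]; [left|right].
  by split => //; apply: IH h.
by exists t, u; split => //; apply: runsW (_ : m <= n) _.
Qed.

Lemma near_vertex ok n a b t u : ok t -> ok u -> V (a 0) t = V (b 0) u ->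
  runs n t (sh 1 a) -> runs n u (sh 1 b) -> code_near ok n a b.
Proof.
move=> ot ou e ra rb; apply: (@nearW _ n n.+1) => //; right; by exists t, u.
Qed.

Lemma near_vertexW ok n m a b t u : m <= n -> ok t -> ok u -> V (a 0) t = V (b 0) u ->
  runs n t (sh 1 a) -> runs n u (sh 1 b) -> code_near ok m a b.
Proof. by move=> mn ot ou e ra rb; apply: nearW mn _; apply: near_vertex e _ _. Qed.

Lemma near_cat ok n m a b : (forall k, k < m -> a k = b k) ->
  code_near ok (n - m) (sh m a) (sh m b) -> code_near ok n a b.
Proof.
elim: m n a b => [|m IH] n a b; first by rewrite subn0.
case: n => [//|n] ab h; left; split; first exact: ab.
by apply: IH => [k km|]; [apply: ab|rewrite !shD add1n].
Qed.

Hypothesis Vinj2 : forall i t u, V i t = V i u -> t = u.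
Hypothesis fx_uniq : forall t c d, fx t c -> fx t d -> c = d.

(** A contact inside one cell is a contact of a vertex with itself, along which both codes run by
    the same letter; so contacts matter only between different first letters. *)
Lemma near_step ok n a b : code_near ok n.+1 a b ->
  (a 0 = b 0 /\ code_near ok n (sh 1 a) (sh 1 b)) \/
  (a 0 <> b 0 /\ exists t u, [/\ ok t, ok u, V (a 0) t = V (b 0) u,
                    runs n t (sh 1 a) & runs n u (sh 1 b)]).
Proof.
case=> [|[t [u [ot ou e ra rb]]]]; first by left.
have [ab|ab] := pselect (a 0 = b 0); last by right; split=> //; exists t, u.
left; split => //; move: e; rewrite ab => /Vinj2 tu; subst u.
by apply: near_agree => k kn; apply: (fx_uniq (t := t)); [apply: ra|apply: rb].
Qed.

End Near.

(* Coarse correspondences: composition and inversion need no triangle inequality. *)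
Definition coarse (X Y : Type) (dX : nat -> X -> X -> Prop) (dY : nat -> Y -> Y -> Prop)
    (m : nat) (M : X -> Y -> Prop) : Prop :=
  [/\ (forall x, exists y, M x y), (forall y, exists x, M x y),
      (forall n x x' y y', M x y -> M x' y' -> dX (m + n)%N x x' -> dY n y y') &
      (forall n x x' y y', M x y -> M x' y' -> dY (m + n)%N y y' -> dX n x x')].

Lemma coarse_inv X Y dX dY m M : @coarse X Y dX dY m M -> @coarse Y X dY dX m (fun y x => M x y).
Proof. by case=> h1 h2 h3 h4; split=> // n x x' y y' Mx Mx'; [apply: h4|apply: h3]. Qed.

Lemma coarse_comp X Y Z dX dY dZ m k M M' :
  @coarse X Y dX dY m M -> @coarse Y Z dY dZ k M' ->
  @coarse X Z dX dZ (m + k)%N (fun x z => exists2 y, M x y & M' y z).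
Proof.
move=> [t1 o1 f1 g1] [t2 o2 f2 g2]; split.
- by move=> x; have [y xy] := t1 x; have [z yz] := t2 y; exists z, y.
- by move=> z; have [y yz] := o2 z; have [x xy] := o1 y; exists x, y.
- move=> n x x' z z' [y xy yz] [y' xy' yz']; rewrite -addnA => h.
  by apply: (f2 _ _ _ _ _ yz yz'); apply: (f1 _ _ _ _ _ xy xy').
- move=> n x x' z z' [y xy yz] [y' xy' yz']; rewrite (addnC m) -addnA => h.
  by apply: (g1 _ _ _ _ _ xy xy'); apply: (g2 _ _ _ _ _ yz yz').
Qed.

Definition anyv (t : vtx) := True.
Definition basev (t : vtx) := t <> VG.

Lemma near_sub T P (V : T -> vtx -> P) fx (ok ok' : vtx -> Prop) n a b :
  (forall t, ok t -> ok' t) -> code_near V fx ok n a b -> code_near V fx ok' n a b.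
Proof.
move=> sub; elim: n a b => [//|n IH] a b [[ab h]|[t [u [ot ou e ra rb]]]]; [left|right].
  by split => //; apply: IH.
by exists t, u; split => //; apply: sub.
Qed.

(** The case without rewriting. A contact of a top with a base vertex continues by a letter fixing
    the top; the shift 1 makes that letter visible. *)
Lemma coarse_unattached T P (V : T -> vtx -> P) fx :
  (forall i t u, V i t = V i u -> t = u) -> (forall i j t, V i t = V j t -> i = j) ->
  (forall t c d, fx t c -> fx t d -> c = d) ->
  (forall i j u c, basev u -> V i VG = V j u -> ~ fx VG c) ->
  coarse (code_near V fx anyv) (code_near V fx basev) 1 eq.
Proof.
move=> V2 V1 fu at_; split; [by move=> x; exists x|by move=> x; exists x|..].
- move=> n a a' b b' <- <-; rewrite add1n; elim: n a a' => [//|n IH] a a'.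
  case/(near_step V2 fu) => [[e h]|[ne [t [u [_ _ e ra rb]]]]]; first by left; split => //; apply: IH.
  right; exists t, u; rewrite /basev; split=> //; try by apply: runsW (leqnSn n) _.
  + move=> tG; subst t; have uG : basev u by move=> uG; subst u; apply: ne; apply: V1 e.
    exact: (at_ _ _ _ _ uG e (ra 0 _)).
  + move=> uG; subst u; have tG : basev t by move=> tG; subst t; apply: ne; apply: V1 e.
    exact: (at_ _ _ _ _ tG (esym e) (rb 0 _)).
- by move=> n a a' b b' <- <- h; apply: nearW (leq_addl 1 n) _; apply: near_sub h.
Qed.

(** * Detaching the top cells *)

(* [nxt a] is the first block of the output for [a], paired with the number of
   letters it has minus one, or with [None] if the block is infinite. *)
Lemma stream_concat (T U : Type) (nxt : (nat -> T) -> (nat -> U) * option nat) :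
  exists G : (nat -> T) -> nat -> U, forall a,
    match (nxt a).2 with
    | None => G a = (nxt a).1
    | Some n => (forall k, k <= n -> G a k = (nxt a).1 k) /\
                sh n.+1 (G a) = G (sh n.+1 a)
    end.
Proof.
(* Every finite block has at least one letter, so fuel [n.+1] suffices for the letter at index
   [n]. *)
pose fix g fuel a n {struct fuel} : U := if fuel is f.+1 then
   match (nxt a).2 with
   | None => (nxt a).1 n
   | Some m => if n <= m then (nxt a).1 n else g f (sh m.+1 a) (n - m.+1)
   end else (nxt a).1 n.
have gE f : forall f' a n, n < f -> n < f' -> g f a n = g f' a n.
  elim: f => [//|f IH] [//|f'] a n nf nf' /=.
  case: (nxt a).2 => [m|//]; case: leqP => // mn; apply: IH; lia.
exists (fun a n => g n.+1 a n) => a.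
case E: (nxt a).2 => [m|]; last by apply/funext => n /=; rewrite E.
split=> [k km /=|]; first by rewrite E km.
apply/funext => n; transitivity (g (m.+1 + n) (sh m.+1 a) n); last by apply: gE; lia.
have gS f c k : g f.+1 c k = match (nxt c).2 with
  | Some l => if k <= l then (nxt c).1 k else g f (sh l.+1 c) (k - l.+1)
  | None => (nxt c).1 k end by [].
by rewrite [LHS]gS E ifN ?addKn // -ltnNge; lia.
Qed.

Section Rewriting.
Local Open Scope nat_scope.
Variables (T : eqType) (P : Type) (V : T -> vtx -> P) (fx : vtx -> T -> Prop).
Variables (L : vtx -> T) (i0 : T) (tg : T -> option (T * vtx)).
Hypothesis Vinj2 : forall i t u, V i t = V i u -> t = u.
Hypothesis Vinj : forall i j t, V i t = V j t -> i = j.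
Hypothesis fxL : forall t c, fx t c <-> c = L t.
Hypothesis Linj : forall t u, L t = L u -> t = u.
Hypothesis isoG : forall j t u, V (L VG) t = V j u -> j = L VG.
Hypothesis corner : forall s j u, V (L s) s = V j u -> j = L s.
Hypothesis base : forall i u s, basev s -> V i VG <> V (L u) s.
Hypothesis i0L : forall t, i0 <> L t.
Hypothesis i0free : forall j s, basev s -> V i0 VG <> V j s.
Hypothesis tgS : forall i j s, tg i = Some (j, s) -> basev s /\ V i VG = V j s.
Hypothesis tgN : forall i j s, tg i = None -> basev s -> V i VG <> V j s.
Implicit Types a b : nat -> T.

Local Notation ga := (L VG).

Definition isrun n x a := forall k, k < n -> a k = x.
(** Such a cell approaches the corner [s] but is isolated: inside [i0] the cell [ga] can be touched
    only at the top of [i0], which is free. *)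
Definition qpat n s a := [/\ isrun n (L s) a, a n = i0 & a n.+1 = ga].

(* The same patterns delimit the windows of the source and of the target. *)
Definition window x a := (tg x <> None /\ isrun 3 ga a) \/
  (exists i s n, tg i = Some (x, s) /\ qpat n.+1 s a).

(* One step of the matching of a code [a] of the gasket with a code [b] in which
   tops touch nothing: the five rewritings of the header, [tg i = Some (j, s)]
   meaning that the top of [i] touches the corner [s] of [j].  The flags [cs] and
   [ct] record whether the maximality of the windows is required of the source and
   of the target. *)
Inductive step (cs ct : Prop) (Q : (nat -> T) -> (nat -> T) -> Prop) a b : Prop :=
| Letter of a 0 = b 0 & (cs -> ~ window (a 0) (sh 1 a)) &
    (ct -> ~ window (b 0) (sh 1 b)) & Q (sh 1 a) (sh 1 b)
| Arm i j s n of tg i = Some (j, s) & a 0 = i & isrun n.+3 ga (sh 1 a) &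
    (cs -> a (n + 4) <> ga) & b 0 = j & qpat n.+1 s (sh 1 b) &
    (ct -> b (n + 4) <> ga) & Q (sh (n + 4) a) (sh (n + 4) b)
| Top i j s of tg i = Some (j, s) & a 0 = i & (forall n, isrun n ga (sh 1 a)) &
    b 0 = j & (forall n, isrun n (L s) (sh 1 b))
| Shift i j s n of tg i = Some (j, s) & a 0 = j & qpat n.+2 s (sh 1 a) &
    b 0 = j & qpat n.+1 s (sh 1 b) & b (n + 4) = ga & Q (sh (n + 5) a) (sh (n + 5) b)
| Free i j s of tg i = Some (j, s) & a 0 = j & qpat 1 s (sh 1 a) &
    b 0 = i & isrun 3 ga (sh 1 b) & Q (sh 4 a) (sh 4 b).

Arguments Letter {cs ct Q a b}.
Arguments Arm {cs ct Q a b i j s n}.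
Arguments Top {cs ct Q a b i j s}.
Arguments Shift {cs ct Q a b i j s n}.
Arguments Free {cs ct Q a b i j s}.

(** The greatest fixed point of [step], encoded as the union of its post-fixed points. *)
Definition matched cs ct a b := exists Q : (nat -> T) -> (nat -> T) -> Prop,
  (forall a b, Q a b -> step cs ct Q a b) /\ Q a b.

Lemma stepW (cs ct cs' ct' : Prop) (Q Q' : (nat -> T) -> (nat -> T) -> Prop) a b :
  (cs' -> cs) -> (ct' -> ct) -> (forall a b, Q a b -> Q' a b) ->
  step cs ct Q a b -> step cs' ct' Q' a b.
Proof.
move=> hs ht QQ [].
- by move=> e ws wt q; apply: Letter => //; auto.
- by move=> i j s n ti ai ra na bj qb nb q; apply: (Arm ti ai ra _ bj qb _ (QQ _ _ q)) => ?; auto.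
- by move=> i j s ti ai ra bj rb; apply: (Top ti ai ra bj rb).
- by move=> i j s n ti aj qa bj qb nb q; apply: (Shift ti aj qa bj qb nb (QQ _ _ q)).
- by move=> i j s ti aj qa bi rb q; apply: (Free ti aj qa bi rb (QQ _ _ q)).
Qed.

Lemma match_step cs ct a b : matched cs ct a b -> step cs ct (matched cs ct) a b.
Proof.
move=> [Q [QQ q]]; apply: stepW (QQ _ _ q) => // a' b' q'; by exists Q.
Qed.

Lemma tg_ga i : tg i = None \/ i <> ga.
Proof.
case E: (tg i) => [[j s]|]; [right|by left] => iga; subst i.
have [bs e] := tgS E; have jg := isoG e; subst j.
by have := Vinj2 e => gs; apply: bs.
Qed.

(** What keeps windows disjoint: [i] has an attached top, unlike [ga] and [i0], and [j] carries a
    top at its base, unlike every corner letter. *)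
Lemma tgt_props i j s : tg i = Some (j, s) ->
  [/\ basev s, i <> ga, i <> i0, (forall u, j <> L u) & V i VG = V j s].
Proof.
move=> ti; have [bs e] := tgS ti; split=> //.
- by case: (tg_ga i) => //; rewrite ti.
- by move=> ii; subst i; apply: i0free e.
- by move=> u ju; subst j; apply: base e.
Qed.

Lemma tg_inj i i' p : tg i = Some p -> tg i' = Some p -> i = i'.
Proof. by case: p => j s /tgS [_ e] /tgS [_ e']; apply: (Vinj (t := VG)); rewrite e e'. Qed.

(** * Matching preserves the patterns that delimit windows *)

Local Notation raw := (matched False False).

Lemma L_neq s : basev s -> L s <> ga. Proof. by move=> bs /Linj; apply: bs. Qed.

Lemma qpat_head n s a : qpat n.+1 s a -> a 0 = L s. Proof. by case=> r _ _; apply: r. Qed.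

(** No window begins with [ga], so a leading [ga] can only be copied. *)
Lemma match_ga a b : raw a b -> a 0 = ga \/ b 0 = ga ->
  a 0 = b 0 /\ raw (sh 1 a) (sh 1 b).
Proof.
move=> /match_step[]; first by split.
- by move=> i j s n /tgt_props[_ ig _ /(_ VG) jG _] -> _ _ -> _ _ _ [].
- by move=> i j s /tgt_props[_ ig _ /(_ VG) jG _] -> _ -> _ [].
- by move=> i j s n /tgt_props[_ ig _ /(_ VG) jG _] -> _ -> _ _ _ [].
- by move=> i j s /tgt_props[_ ig _ /(_ VG) jG _] -> _ -> _ _ [].
Qed.

(** A base letter can begin a window only as an arm, hence followed by [ga]; any other second letter
    leaves plain copying. *)
Lemma match_L a b s : raw a b -> basev s -> (a 0 = L s /\ a 1 <> ga) \/ (b 0 = L s /\ b 1 <> ga) ->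
  a 0 = b 0 /\ raw (sh 1 a) (sh 1 b).
Proof.
move=> /match_step h bs; case: h; first by split.
- move=> i j u n /tgt_props[_ ig _ jL _] -> r _ -> _ _ _ [[_]|[/jL //]].
  by have := r 0 isT; rewrite /sh /= => ->.
- move=> i j u /tgt_props[_ ig _ jL _] -> r -> _ [[_]|[/jL //]].
  by have := r 1 0 isT; rewrite /sh /= => ->.
- by move=> i j u n /tgt_props[_ ig _ jL _] -> _ -> _ _ _ [[/jL]|[/jL]].
- move=> i j u /tgt_props[_ ig _ jL _] -> _ -> r _ [[/jL //]|[_]].
  by have := r 0 isT; rewrite /sh /= => ->.
Qed.

(** [i0] can begin a window only as a touched cell, hence followed by a base corner letter; a
    following [ga] leaves plain copying. *)
Lemma match_i0 a b : raw a b -> (a 0 = i0 /\ a 1 = ga) \/ (b 0 = i0 /\ b 1 = ga) ->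
  a 0 = b 0 /\ raw (sh 1 a) (sh 1 b).
Proof.
move=> /match_step h; case: h; first by split.
- move=> i j u n /tgt_props[bu _ ii _ _] -> _ _ -> /qpat_head; rewrite /sh /= => -> _ _.
  by case=> [[/ii]|[_ /(L_neq bu)]].
- move=> i j u /tgt_props[bu _ ii _ _] -> _ -> r.
  by have := r 1 0 isT; rewrite /sh /= => -> [[/ii]|[_ /(L_neq bu)]].
- move=> i j u n /tgt_props[bu _ ii _ _] -> /qpat_head ea -> /qpat_head eb _ _.
  by move: ea eb; rewrite /sh /= => -> -> [[_ /(L_neq bu)]|[_ /(L_neq bu)]].
- move=> i j u /tgt_props[bu _ ii _ _] -> /qpat_head ea -> _ _.
  by move: ea; rewrite /sh /= => -> [[_ /(L_neq bu)]|[/ii]].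
Qed.

Lemma match_garun n a b : raw a b -> isrun n ga a <-> isrun n ga b.
Proof.
elim: n a b => [|n IH] a b m; first by split=> _ k.
split=> r.
- have [e m'] := match_ga m (or_introl (r 0 isT)).
  case=> [_|k kn]; first by rewrite -e; apply: r.
  by apply: (proj1 (IH _ _ m') _ k kn) => l ln; apply: r.
- have [e m'] := match_ga m (or_intror (r 0 isT)).
  case=> [_|k kn]; first by rewrite e; apply: r.
  by apply: (proj2 (IH _ _ m') _ k kn) => l ln; apply: r.
Qed.

Lemma qpatS n s a : qpat n.+1 s a <-> a 0 = L s /\ qpat n s (sh 1 a).
Proof.
split=> [[r q g]|[e [r q g]]]; split=> //; first exact: r.
  by split=> // k kn; apply: r.
by case=> [//|k kn]; apply: r.
Qed.

Lemma qpat_1 n s a : basev s -> qpat n.+1 s a -> a 1 <> ga.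
Proof.
move=> bs /qpatS[_]; case: n => [[_ q _]|n /qpatS[e _]].
  by rewrite (_ : a 1 = i0) //; apply: i0L.
by rewrite (_ : a 1 = L s) //; apply: L_neq.
Qed.

Lemma match_qpat n s a b : raw a b -> basev s -> qpat n s a <-> qpat n s b.
Proof.
move=> m bs; elim: n a b m => [|n IH] a b m.
  split=> [] [_ q g].
    have [e m'] := match_i0 m (or_introl (conj q g)).
    by split=> //; rewrite -?e //; have [e' _] := match_ga m' (or_introl g); exact: etrans (esym e') g.
  have [e m'] := match_i0 m (or_intror (conj q g)).
  by split=> //; rewrite ?e //; have [e' _] := match_ga m' (or_intror g); exact: etrans e' g.
split=> q; have := q => /qpatS[e q'].
  have [|ab m'] := match_L m bs; first by left; split=> //; apply: qpat_1 q.
  by apply/qpatS; split; [rewrite -ab|apply/(IH _ _ m')].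
have [|ab m'] := match_L m bs; first by right; split=> //; apply: qpat_1 q.
by apply/qpatS; split; [rewrite ab|apply/(IH _ _ m')].
Qed.

Lemma match_window x a b : raw a b -> window x a <-> window x b.
Proof.
move=> m; split=> [] [[tx r]|[i [s [n [ti q]]]]].
- by left; split=> //; apply/(match_garun _ m).
- by right; exists i, s, n; split=> //; have [bs _] := tgS ti; apply/(match_qpat _ m bs).
- by left; split=> //; apply/(match_garun _ m).
- by right; exists i, s, n; split=> //; have [bs _] := tgS ti; apply/(match_qpat _ m bs).
Qed.

Lemma match_raw cs ct a b : matched cs ct a b -> raw a b.
Proof.
move=> [Q [QQ q]]; exists Q; split=> // a' b' /QQ; exact: stepW.
Qed.

(** A construction guided by one side secures maximality there. The other side inherits it, because
    matched tails show the same windows and the same leading [ga]. *)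
Lemma match_strict (cs ct : Prop) a b : cs \/ ct -> matched cs ct a b -> matched True True a b.
Proof.
move=> hc m; exists (matched cs ct); split=> // {m}a {}b /match_step[].
- move=> e ws wt m; have w := match_window (a 0) (match_raw m).
  have nw : ~ window (a 0) (sh 1 a) by case: hc => c; [apply: ws|rewrite w e; apply: wt].
  by apply: Letter => // _; rewrite -e -w.
- move=> i j s n ti ai ra na bj qb nb m.
  have w := match_ga (match_raw m); rewrite /sh !addn0 in w.
  have na' : a (n + 4) <> ga.
    by case: hc => c h; [apply: na|apply: (nb c); have [<-] := w (or_introl h)].
  by apply: (Arm ti ai ra _ bj qb _ m) => // _ h; have [e _] := w (or_intror h); apply: na'; rewrite e.
- exact: @Top.
- exact: @Shift.
- exact: @Free.
Qed.

(** * Existence of partners *)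

Local Notation M := (matched True True).

(** Continued by [ga] forever, so that the prefixes of n+4 and n+5 letters are the output blocks of
    [Arm] and [Shift]. *)
Let boundary j s n : nat -> T := fun k =>
  if k == 0 then j else if k <= n.+1 then L s else if k == n.+2 then i0 else ga.
Let arm i : nat -> T := fun k => if k == 0 then i else ga.

Lemma boundaryP j s n m a : (forall k, k <= m -> a k = boundary j s n k) -> n + 3 <= m ->
  [/\ a 0 = j, qpat n.+1 s (sh 1 a) & n + 4 <= m -> a (n + 4) = ga].
Proof.
move=> e nm; have hi k : n + 2 < k -> boundary j s n k = ga.
  by move=> nk; rewrite /boundary; case: eqP => [|_]; [lia|
    case: leqP => [|_]; [lia|case: eqP => //; lia]].
split; first exact: e.
  split=> [k kn||]; last by rewrite /sh e; [apply: hi|]; lia.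
    by rewrite /sh e; [rewrite /boundary add1n /= kn|lia].
  by rewrite /sh e; [rewrite /boundary add1n /= ltnn eqxx|lia].
by move=> nm'; rewrite e; [apply: hi|]; lia.
Qed.

Lemma armP i m n a : (forall k, k <= m -> a k = arm i k) -> n <= m ->
  a 0 = i /\ isrun n ga (sh 1 a).
Proof.
by move=> e nm; split=> [|k kn]; [exact: e|rewrite /sh e //; lia].
Qed.

Lemma garun_cases a : isrun 3 ga (sh 1 a) ->
  (exists2 n, isrun n.+3 ga (sh 1 a) & a (n + 4) <> ga) \/ forall n, isrun n ga (sh 1 a).
Proof.
move=> r3; have [ex|al] := pselect (exists k, sh 1 a k != ga); last first.
  by right=> n k _; apply/eqP; apply: contrapT => /negP h; apply: al; exists k.
left; case: (ex_minnP ex) => m /eqP nm mmin.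
have m3 : 3 <= m by rewrite leqNgt; apply/negP => m3; apply: nm; apply: r3.
exists (m - 3).
  by move=> k km; apply/eqP/negPn/negP => /mmin; lia.
by move=> h; apply: nm; rewrite /sh -h; congr (a _); lia.
Qed.

(** [Q] stays arbitrary so that it can become the graph of the concatenated output. *)
Lemma source_step a : exists ol : (nat -> T) * option nat, forall Q b,
  match ol.2 with
  | None => b = ol.1
  | Some n => (forall k, k <= n -> b k = ol.1 k) /\ Q (sh n.+1 a) (sh n.+1 b)
  end -> step True False Q a b.
Proof.
have [[[ta r]|[i [s [n [ti q]]]]]|nw] := pselect (window (a 0) (sh 1 a)).
- case ti: (tg (a 0)) ta => [[j s]|//] _.
  have [[n rn an]|ri] := garun_cases r.
    exists (boundary j s n, Some (n + 3)) => Q b /= [e q].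
    have [b0 qb _] := boundaryP e (leqnn _).
    by apply: (Arm ti erefl rn _ b0 qb _ _) => //; move: q; rewrite -addnS.
  exists (fun k => if k == 0 then j else L s, None) => Q b /= ->.
  by apply: (Top ti erefl ri) => // k l.
(* The hotel: the room with a single [L s] empties into the arm, every other room moves down by
   one. *)
- case: n q => [|n] q.
    exists (arm i, Some 3) => Q b /= [e m].
    by have [b0 rb] := armP e (leqnn _); apply: (Free ti erefl q b0 rb m).
  exists (boundary (a 0) s n, Some (n + 4)) => Q b /= [e m].
  have [|b0 qb nb] := boundaryP e; first lia.
  by apply: (Shift ti erefl q b0 qb (nb (leqnn _))); move: m; rewrite -addnS.
- exists (a, Some 0) => Q b /= [e m].
  by apply: Letter => //; rewrite e.
Qed.

Lemma target_step b : exists ol : (nat -> T) * option nat, forall Q a,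
  match ol.2 with
  | None => a = ol.1
  | Some n => (forall k, k <= n -> a k = ol.1 k) /\ Q (sh n.+1 a) (sh n.+1 b)
  end -> step False True Q a b.
Proof.
have [[[tb r]|[i [s [n [ti q]]]]]|nw] := pselect (window (b 0) (sh 1 b)).
- case ti: (tg (b 0)) tb => [[j s]|//] _.
  exists (boundary j s 0, Some 3) => Q a /= [e m].
  have [a0 qa _] := boundaryP e (leqnn _).
  by apply: (Free ti a0 qa erefl r m).
(* The block j l^(n+1) i0 g comes from the next longer room if another [ga] follows, and from an arm
   otherwise. *)
- have [nb|nb] := pselect (b (n + 4) = ga).
    exists (boundary (b 0) s n.+1, Some (n + 4)) => Q a /= [e m].
    have [|a0 qa _] := boundaryP e; first lia.
    by apply: (Shift ti a0 qa erefl q nb); move: m; rewrite -addnS.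
  exists (arm i, Some (n + 3)) => Q a /= [e m].
  have [a0 ra] := armP e (leqnn _); rewrite addnC in ra.
  by apply: (Arm ti a0 ra _ erefl q) => //; move: m; rewrite -addnS.
- exists (b, Some 0) => Q a /= [e m].
  by apply: Letter => //; rewrite e.
Qed.

Lemma match_total a : exists b, M a b.
Proof.
have [nxt nxtP] := choice source_step; have [G GP] := stream_concat nxt.
exists (G a); apply: (@match_strict True False); first by left.
exists (fun a b => b = G a); split=> // {}a b ->; apply: nxtP.
by move: (GP a); case: (nxt a).2.
Qed.

Lemma match_onto b : exists a, M a b.
Proof.
have [nxt nxtP] := choice target_step; have [G GP] := stream_concat nxt.
exists (G b); apply: (@match_strict False True); first by right.
exists (fun a b => a = G b); split=> // a {}b ->; apply: nxtP.
by move: (GP b); case: (nxt b).2.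
Qed.

(** * Rigidity of nearness at isolated cells *)

Lemma runsE n t a : runs fx n t a <-> isrun n (L t) a.
Proof. by split=> r k kn; apply/fxL; apply: r. Qed.

Lemma fx_fun t c d : fx t c -> fx t d -> c = d.
Proof. by move=> /fxL -> /fxL ->. Qed.

Let near_step' := near_step Vinj2 fx_fun.
Local Notation near := (code_near V fx).

(** Since [ga] touches no other cell, nearness forces equal letters along the whole run. *)
Lemma near_garun ok k n a b : near ok (k + n) a b -> isrun k ga a ->
  isrun k ga b /\ near ok n (sh k a) (sh k b).
Proof.
elim: k a b => [|k IH] a b; first by move=> h _; split.
rewrite addSn => /near_step'[[e h]|[ne [t [u [_ _ e _ _]]]]] r; last first.
  by case: ne; move: e; rewrite (r 0) // => /isoG ->.
have [|r' h'] := IH _ _ h; first by move=> l lk; apply: r.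
split; last by move: h'; rewrite !shD add1n.
by case=> [_|l lk]; [rewrite -e; apply: r|apply: r'].
Qed.

(** The second letter of [a] tells at which vertex of [L s] a contact is possible: [i0] allows none,
    [L s] only the corner [s], which no other cell touches. *)
Lemma near_L ok n a b s : near ok n.+2 a b -> a 0 = L s -> a 1 = L s \/ a 1 = i0 ->
  b 0 = L s /\ near ok n.+1 (sh 1 a) (sh 1 b).
Proof.
move=> /near_step'[[<- h] //|[ne [t [u [_ _ e ra _]]]]] a0 a1.
have := proj1 (fxL _ _) (ra 0 isT); rewrite /sh addn0 => a1'.
case: a1 => [a1|a1]; last by case: (@i0L t); rewrite -a1.
have st : s = t by apply: Linj; rewrite -a1 -a1'.
by case: ne; subst t; move: e; rewrite a0 => /corner ->.
Qed.

(** Corner letters are forced by [near_L]; the [ga] after [i0] admits a contact only at the free top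
    of [i0]. *)
Lemma near_qpat ok k n s a b : near ok (k + n.+2) a b -> qpat k s a ->
  qpat k s b /\ near ok n (sh k.+2 a) (sh k.+2 b).
Proof.
elim: k a b => [|k IH] a b.
  rewrite add0n => /near_step'[[e h]|[ne [t [u [_ _ e ra _]]]]] [_ a0 a1]; last first.
    case: ne; have := proj1 (fxL _ _) (ra 0 isT); rewrite /sh addn0 a1 => /Linj tG; subst t.
    case: u e ra => [] e _; move: e; rewrite a0; try by move/i0free; case.
    exact: Vinj.
  have [|r h'] := @near_garun ok 1 n _ _ h; first by case.
  split; first by split=> //; [rewrite -e|apply: (r 0)].
  by move: h'; rewrite !shD.
rewrite addSn addnS => h /qpatS[a0 q].
have a1 : a 1 = L s \/ a 1 = i0.
  by case: k q {IH h} => [[_ q _]|k /qpatS[q _]]; [right|left].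
have [b0 h1] := near_L h a0 a1; rewrite -addnS in h1.
by have [q' h'] := IH _ _ h1 q; split; [apply/qpatS|move: h'; rewrite !shD].
Qed.

Lemma near_Lrun ok n s a b : near ok n a b -> isrun n (L s) a -> isrun n.-1 (L s) b.
Proof.
elim: n a b => [|[|n] IH] a b; try by move=> _ _ k.
move=> h r; have [b0 h'] := near_L h (r 0 isT) (or_introl (r 1 isT)).
have r' := IH _ _ h' (fun k kn => r k.+1 kn).
by case=> [_|k kn] //; apply: r'.
Qed.

Lemma qpat_uniq n n' s s' a : qpat n.+1 s a -> qpat n'.+1 s' a -> n = n' /\ s = s'.
Proof.
move=> q q'; have s_eq : s = s'.
  by apply: Linj; rewrite -(qpat_head q) -(qpat_head q').
split=> //; subst s'; case: q q' => [r e _] [r' e' _].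
case: (ltngtP n n') => // h.
- by case: (@i0L s); rewrite -e r'.
- by case: (@i0L s); rewrite -e' r.
Qed.

(** * Matching preserves nearness up to eight levels *)

Lemma match_Lrun n s a b : raw a b -> basev s ->
  (isrun n.+1 (L s) a -> isrun n (L s) b) /\ (isrun n.+1 (L s) b -> isrun n (L s) a).
Proof.
move=> m bs; elim: n a b m => [|n IH] a b m; first by split=> _ k.
split=> r.
- have [|e m'] := match_L m bs; first by left; rewrite !r //; split=> //; apply: L_neq.
  case=> [_|k kn]; first by rewrite -e r.
  by apply: (proj1 (IH _ _ m') _ k kn) => l ln; apply: r.
- have [|e m'] := match_L m bs; first by right; rewrite !r //; split=> //; apply: L_neq.
  case=> [_|k kn]; first by rewrite e r.
  by apply: (proj2 (IH _ _ m') _ k kn) => l ln; apply: r.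
Qed.

Lemma isrunW m n x a : m <= n -> isrun n x a -> isrun m x a.
Proof. by move=> mn r k km; apply: r; apply: leq_trans mn. Qed.

Lemma garun_L s a : basev s -> a 0 = L s -> isrun 3 ga a -> False.
Proof. by move=> bs e r; apply: (L_neq bs); rewrite -e r. Qed.

(** Near a contact vertex, matching leads to a code near the same vertex, seen from a base corner.
    Three letters [ga] force a window, and g^(n+3) becomes l^(n+1); this explains the loss of
    three. *)
Lemma match_vertex a b t y u K : M a b -> basev u -> V (a 0) t = V y u ->
  isrun K.+3 (L t) (sh 1 a) ->
  exists w, [/\ basev w, V (b 0) w = V (a 0) t & isrun K (L w) (sh 1 b)].
Proof.
move=> /match_step h bu e r.
have [tG|bt] : t = VG \/ basev t by case: (t); [right|right|left].
  subst t; case: h.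
  - move=> _ /(_ I) w _ _; case: w; left; split; last by apply: (isrunW _ r); lia.
    by move=> tn; apply: tgN tn bu e.
  - move=> i j s n ti ai ra /(_ I) na bj [rb _ _] _ _; exists s.
    have [bs _ _ _ ij] := tgt_props ti; split; rewrite ?ai ?bj //.
    apply: (isrunW _ rb); rewrite leqNgt; apply/negP => nK; apply: na.
    by have := r (n + 3); rewrite /sh add1n -addnS; apply; lia.
  - move=> i j s ti ai ra bj rb; exists s.
    by have [bs _ _ _ ij] := tgt_props ti; split; rewrite ?ai ?bj.
  - move=> i j s n ti _ qa _ _ _ _; have [bs _ _ _ _] := tgt_props ti.
    by case: (garun_L bs (qpat_head qa)); apply: (isrunW _ r); lia.
  - move=> i j s ti _ qa _ _ _; have [bs _ _ _ _] := tgt_props ti.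
    by case: (garun_L bs (qpat_head qa)); apply: (isrunW _ r); lia.
case: h.
- move=> ab _ _ m; exists t; split; rewrite -?ab //.
  apply: (proj1 (match_Lrun _ (match_raw m) bt)). apply: (isrunW _ r); lia.
- move=> i j s n _ _ ra _ _ _ _ _; by case: (@garun_L t (sh 1 a) bt (r 0 isT)); apply: (isrunW _ ra).
- by move=> i j s _ _ ra _ _; case: (garun_L bt (r 0 isT)).
- move=> i j s n ti aj [ra ea _] bj [rb _ _] _ _.
  have st : t = s by apply: Linj; rewrite -(r 0) // -(ra 0).
  subst t; exists s; split; rewrite ?aj ?bj //; apply: (isrunW _ rb).
  by rewrite leqNgt; apply/negP => nK; case: (@i0L s); rewrite -ea r //; lia.
- move=> i j s ti aj [ra ea _] _ _ _.
  by case: (@i0L t); rewrite -ea r.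
Qed.

(** Backwards the vertex may reappear as the top of an arm, so [w] is not confined to the base. *)
Lemma match_vertex_inv a b t K : M a b -> basev t -> isrun K.+3 (L t) (sh 1 b) ->
  exists w, V (a 0) w = V (b 0) t /\ isrun K (L w) (sh 1 a).
Proof.
move=> /match_step h bt r; case: h.
- move=> ab _ _ m; exists t; rewrite ab; split=> //.
  by apply: (proj2 (match_Lrun _ (match_raw m) bt)); apply: (isrunW _ r); lia.
- move=> i j s n ti ai ra _ bj [rb eb _] _ _.
  have st : t = s by apply: Linj; rewrite -(r 0) // -(rb 0).
  subst t; exists VG; have [_ _ _ _ ij] := tgt_props ti; split; rewrite ?ai ?bj //.
  apply: (isrunW _ ra); rewrite leqNgt; apply/negP => nK.
  by case: (@i0L s); rewrite -eb r //; lia.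
- move=> i j s ti ai ra bj rb.
  have st : t = s by apply: Linj; rewrite -(r 0) // -(rb 1 0).
  subst t; exists VG; have [_ _ _ _ ij] := tgt_props ti; split; rewrite ?ai ?bj //.
- move=> i j s n ti aj [ra _ _] bj [rb eb _] _ _.
  have st : t = s by apply: Linj; rewrite -(r 0) // -(rb 0).
  subst t; exists s; split; rewrite ?aj ?bj //; apply: (isrunW _ ra).
  by rewrite leqNgt; apply/negP => nK; case: (@i0L s); rewrite -eb r //; lia.
- by move=> i j s _ _ _ _ rb _; case: (garun_L bt (r 0 isT)).
Qed.

Lemma near_match_vertices ok l n a a' t t' : l <= n -> ok t -> ok t' ->
  V (a 0) t = V (a' 0) t' -> isrun n (L t) (sh 1 a) -> isrun n (L t') (sh 1 a') ->
  near ok l a a'.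
Proof.
by move=> ln ot ot' e r r'; apply: near_vertexW ln ot ot' e _ _; apply/runsE.
Qed.

Lemma match_near_vertices l y u a b a' b' t t' : M a b -> M a' b' -> basev u ->
  V (a 0) t = V y u -> V (a' 0) t' = V y u ->
  isrun l.+3 (L t) (sh 1 a) -> isrun l.+3 (L t') (sh 1 a') -> near basev l b b'.
Proof.
move=> m m' bu e e' r r'.
have [w [bw ew rw]] := match_vertex m bu e r.
have [w' [bw' ew' rw']] := match_vertex m' bu e' r'.
by apply: near_match_vertices (leqnn l) bw bw' _ rw rw'; rewrite ew ew' e e'.
Qed.

Lemma match_near_vertices_inv l a b a' b' t t' : M a b -> M a' b' -> basev t -> basev t' ->
  V (b 0) t = V (b' 0) t' ->
  isrun l.+3 (L t) (sh 1 b) -> isrun l.+3 (L t') (sh 1 b') -> near anyv l a a'.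
Proof.
move=> m m' bt bt' e r r'.
have [w [ew rw]] := match_vertex_inv m bt r.
have [w' [ew' rw']] := match_vertex_inv m' bt' r'.
by apply: (near_match_vertices (leqnn l) _ _ _ rw rw') => //; rewrite ew ew' e.
Qed.

(** [X] and [Y] select source or target, so that one induction hypothesis serves both directions; 8
    is a margin for the losses at runs and windows. *)
Definition transfers okX okY l (X Y : (nat -> T) -> (nat -> T) -> (nat -> T)) := forall k a a' b b',
  k <= l -> M a b -> M a' b' -> near okX (8 + k) (X a b) (X a' b') ->
  near okY k (Y a b) (Y a' b').

(** Rewriting preserves lengths, so after a common block the margin 8 is still whole; it is spent
    only once, where the codes part. *)
Lemma transfers_tail okX okY l X Y n m a a' b b' : transfers okX okY l X Y -> M a b -> M a' b' ->
  8 + l <= m + n -> near okX m (X a b) (X a' b') -> near okY (l.+1 - n.+1) (Y a b) (Y a' b').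
Proof.
move=> h mm mm' lm nn; rewrite subSS.
have [nl|ln] := leqP n l; last by rewrite (_ : l - n = 0) //; lia.
by apply: h => //; [lia|apply: nearW nn; lia].
Qed.

Lemma boundary_agree n s a b : a 0 = b 0 -> qpat n.+1 s (sh 1 a) -> qpat n.+1 s (sh 1 b) ->
  forall k, k < n + 4 -> a k = b k.
Proof.
move=> e0 [ra ea ga_] [rb eb gb] [//|k] kn.
have [kn'|kn'] := ltnP k n.+1; first by move: (ra k kn') (rb k kn'); rewrite /sh !add1n => -> ->.
have [->|kn2] := eqVneq k n.+1; first by move: ea eb; rewrite /sh !add1n => -> ->.
by have -> : k = n.+2; [lia|move: ga_ gb; rewrite /sh !add1n => -> ->].
Qed.

Lemma garun_agree n a b : a 0 = b 0 -> isrun n ga (sh 1 a) -> isrun n ga (sh 1 b) ->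
  forall k, k < n.+1 -> a k = b k.
Proof.
move=> e0 ra rb [//|k] kn; have kn' : k < n by [].
by move: (ra k kn') (rb k kn'); rewrite /sh !add1n => -> ->.
Qed.

Lemma near_ga_next ok n m a a' : near ok n.+1 (sh m a) (sh m a') -> a m = ga -> a' m = ga.
Proof.
move=> h e; have [|r _] := @near_garun ok 1 n (sh m a) (sh m a') h.
  by case=> // _; rewrite /sh addn0.
by have := r 0 isT; rewrite /sh addn0.
Qed.

(** Either the window outlasts the level and both codes stay near a common vertex, or rigidity
    copies the whole pattern to [a']. Then its step has the same kind and parameters, the output
    blocks agree, and induction treats the tails. *)
Lemma match_near_window l a a' b b' : transfers anyv basev l (fun a _ => a) (fun _ b => b) ->
  M a b -> M a' b' -> a 0 = a' 0 -> near anyv (8 + l) (sh 1 a) (sh 1 a') ->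
  window (a 0) (sh 1 a) -> near basev l.+1 b b'.
Proof.
move=> IH m m' a0 h w; have long i j s : tg i = Some (j, s) -> a 0 = i ->
    isrun (8 + l) ga (sh 1 a) -> near basev l.+1 b b'.
  move=> ti ai r; have [bs _ _ _ e] := tgt_props ti.
  have [r' _] := @near_garun _ _ 0 _ _ (eq_rect_r (fun k => near anyv k _ _) h (addn0 _)) r.
  by apply: (@match_near_vertices l.+1 j s a b a' b' VG VG m m') => //;
    rewrite -?a0 ?ai //; apply: isrunW; [|exact: r| |exact: r']; lia.
have := m => /match_step[].
- by move=> _ /(_ I).
- move=> i j s n ti ai ra /(_ I) na bj qb _ m1.
  have [ln|nl] := leqP (8 + l) n.+3; first by apply: (long _ _ _ ti ai); apply: isrunW ra.
  have [bs ig ii jL _] := tgt_props ti.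
  have h' : near anyv (n.+3 + (5 + l - n)) (sh 1 a) (sh 1 a') by apply: nearW h; lia.
  have [r' h1] := near_garun h' ra; rewrite !shD in h1.
  (* The two runs end together: nearness would carry a further [ga] of [a'] back to [a]. *)
  have na' : a' (n + 4) <> ga.
    move=> e; apply: na; rewrite addnC.
    apply: (@near_ga_next anyv (4 + l - n) (4 + n) a' a); last by rewrite addnC.
    by apply: near_sym; apply: nearW h1; lia.
  have := m' => /match_step[].
  + move=> _ /(_ I) w'; case: w'; left. rewrite -a0 ai ti; split=> //.
    by apply: isrunW r'.
  + move=> i' j' s' n' ti' ai' ra' /(_ I) na1 bj' qb' _ m1'.
    have ii' : i' = i by rewrite -ai' -a0.
    move: ti'; rewrite ii' ti => -[jj ss]; rewrite -ss in qb'.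
    have nn : n' = n.
      apply/eqP; rewrite eqn_leq; apply/andP; split; rewrite leqNgt; apply/negP => lt.
        by apply: na'; have := ra' (n + 3); rewrite /sh add1n -addnS; apply; lia.
      by apply: na1; have := r' (n' + 3); rewrite /sh add1n -addnS; apply; lia.
    rewrite nn in qb' m1'; apply: (@near_cat _ _ _ _ _ _ (n + 4)).
      by apply: boundary_agree qb qb'; rewrite bj bj' jj.
    have := transfers_tail (m := 5 + l - n) (n := n + 3) IH m1 m1'; rewrite -addnS; apply; first lia.
    by move: h1; rewrite (_ : 1 + n.+3 = n + 4) //; lia.
  + move=> i' j' s' _ _ ra' _ _; case: na'.
    by have := ra' (n + 4) (n + 3); rewrite /sh add1n -addnS; apply; lia.
  + move=> i' j' s' n' ti' _ q' _ _ _ _; have [bs' _ _ _ _] := tgt_props ti'.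
    by case: (garun_L bs' (qpat_head q')); apply: (isrunW _ r').
  + move=> i' j' s' ti' _ q' _ _ _; have [bs' _ _ _ _] := tgt_props ti'.
    by case: (garun_L bs' (qpat_head q')); apply: (isrunW _ r').
- by move=> i j s ti ai ra _ _; apply: (long _ _ _ ti ai).
- move=> i j s n ti aj qa bj qb nb m1; have [bs _ _ _ _] := tgt_props ti.
  have [nl|ln] := leqP (n + 4) (8 + l); last first.
    have [ra _ _] := qa; have ra1 : isrun (6 + l) (L s) (sh 1 a) by apply: isrunW ra; lia.
    have ra2 := near_Lrun (nearW (_ : 6 + l <= 8 + l) h) ra1.
    apply: (@match_near_vertices l.+1 j s a b a' b' s s m m') => //;
      rewrite -?a0 ?aj //; apply: isrunW; [|exact: ra1| |apply: ra2]; lia.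
  have h' : near anyv (n.+2 + (4 + l - n).+2) (sh 1 a) (sh 1 a') by apply: nearW h; lia.
  have [qa' h1] := near_qpat h' qa; rewrite !shD in h1.
  have := m' => /match_step[].
  + by move=> _ /(_ I) w'; case: w'; right; rewrite -a0 aj; exists i, s, n.+1.
  + move=> i' j' s' n' _ _ r' _ _ _ _ _.
    by case: (garun_L bs (qpat_head qa')); apply: (isrunW _ r').
  + by move=> i' j' s' _ _ r' _ _; case: (garun_L bs (qpat_head qa')).
  + move=> i' j' s' n' ti' aj' q' bj' qb' nb' m1'.
    have [[nn] ss] := qpat_uniq qa' q'; rewrite -ss -nn in qb' nb' m1'.
    have jj : j' = j by rewrite -aj' -a0.
    apply: (@near_cat _ _ _ _ _ _ (n + 5)).
      move=> k kn; have [->|kn4] := eqVneq k (n + 4); first by rewrite nb nb'.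
      by apply: (boundary_agree _ qb qb'); [rewrite bj bj' jj|lia].
    have := transfers_tail (m := 4 + l - n) (n := n + 4) IH m1 m1'; rewrite -addnS; apply; first lia.
    by move: h1; rewrite (_ : 1 + n.+4 = n + 5) //; lia.
  + by move=> i' j' s' _ _ q' _ _ _; have [] := qpat_uniq qa' q'.
- move=> i j s ti aj qa bi rb m1; have [bs _ _ _ _] := tgt_props ti.
  have h' : near anyv (1 + (5 + l).+2) (sh 1 a) (sh 1 a') by apply: nearW h; lia.
  have [qa' h1] := near_qpat h' qa; rewrite !shD in h1.
  have := m' => /match_step[].
  + by move=> _ /(_ I) w'; case: w'; right; rewrite -a0 aj; exists i, s, 0.
  + move=> i' j' s' n' _ _ r' _ _ _ _ _.
    by case: (garun_L bs (qpat_head qa')); apply: (isrunW _ r').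
  + by move=> i' j' s' _ _ r' _ _; case: (garun_L bs (qpat_head qa')).
  + by move=> i' j' s' n' _ _ q' _ _ _ _; have [] := qpat_uniq qa' q'.
  + move=> i' j' s' ti' aj' q' bi' rb' m1'.
    have [_ ss] := qpat_uniq qa' q'.
    have jj : j' = j by rewrite -aj' -a0.
    (* Only one top reaches a given corner, so both codes enter the same arm. *)
    rewrite jj -ss in ti'; have ii := tg_inj ti ti'.
    apply: (@near_cat _ _ _ _ _ _ 4).
      by apply: garun_agree rb rb'; rewrite bi bi' ii.
    by apply: (transfers_tail (m := 5 + l) (n := 3) IH m1 m1') => //; lia.
Qed.

Lemma match_near n a a' b b' : M a b -> M a' b' -> near anyv (8 + n) a a' -> near basev n b b'.
Proof.
move: n a a' b b'.
suff H l : transfers anyv basev l (fun a _ => a) (fun _ b => b).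
  by move=> n a a' b b'; apply: (H n).
elim: l => [|l IH] k a a' b b'; first by rewrite leqn0 => /eqP ->.
rewrite leq_eqVlt => /orP[/eqP ->|]; last by rewrite ltnS; apply: IH.
move=> m m'; rewrite addnS => h; have := h => /near_step'[[a0 h1]|[ne [t [u [_ _ e ra rb]]]]].
  have [w|nw] := pselect (window (a 0) (sh 1 a)); first exact: match_near_window h1 w.
  have [w|nw'] := pselect (window (a' 0) (sh 1 a')).
    exact: near_sym (match_near_window IH m' m (esym a0) (near_sym h1) w).
  have w0 c d : M c d -> ~ window (c 0) (sh 1 c) -> c 0 = d 0 /\ M (sh 1 c) (sh 1 d).
    move=> /match_step[] //.
    + move=> i j s n' ti ci r _ _ _ _ _; case; left; rewrite ci ti; split=> //.
      exact: (isrunW _ r).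
    + by move=> i j s ti ci r _ _; case; left; rewrite ci ti.
    + by move=> i j s n' ti ci q _ _ _ _; case; right; exists i, s, n'.+1; rewrite ci.
    + by move=> i j s ti ci q _ _ _; case; right; exists i, s, 0; rewrite ci.
  have [b0 m1] := w0 _ _ m nw; have [b0' m1'] := w0 _ _ m' nw'.
  left; split; first by rewrite -b0 -b0'.
  exact: IH h1.
(* Different cells cannot share their tops, so one of the two contact vertices is a base vertex, as
   [match_near_vertices] demands. *)
have [uG|bu] := pselect (u = VG).
  subst u; have bt : basev t by move=> tG; subst t; apply: ne; apply: Vinj e.
  apply: (@match_near_vertices l.+1 (a 0) t a b a' b' t VG m m' bt) => //;
    apply: isrunW; [|by apply/runsE; exact: ra| |by apply/runsE; exact: rb]; lia.
apply: (@match_near_vertices l.+1 (a' 0) u a b a' b' t u m m' bu) => //;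
  apply: isrunW; [|by apply/runsE; exact: ra| |by apply/runsE; exact: rb]; lia.
Qed.

Lemma match_near_longrun l a a' b b' s : M a b -> M a' b' -> basev s -> b 0 = b' 0 ->
  near basev (8 + l) (sh 1 b) (sh 1 b') -> isrun (6 + l) (L s) (sh 1 b) -> near anyv l.+1 a a'.
Proof.
move=> m m' bs b0 h r; have r' := near_Lrun (nearW (_ : 6 + l <= 8 + l) h) r.
apply: (@match_near_vertices_inv l.+1 a b a' b' s s m m' bs bs); first by rewrite b0.
  by apply: (isrunW _ r); lia.
by apply: (isrunW _ (r' _)); lia.
Qed.

(** As in the forward direction. In the target [Arm] and [Shift] begin with the same pattern and are
    told apart by the letter after it, which nearness also controls. *)
Lemma match_near_window_inv l a a' b b' : transfers basev anyv l (fun _ b => b) (fun a _ => a) ->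
  M a b -> M a' b' -> b 0 = b' 0 -> near basev (8 + l) (sh 1 b) (sh 1 b') ->
  window (b 0) (sh 1 b) -> near anyv l.+1 a a'.
Proof.
move=> IH m m' b0 h w; have := m => /match_step[].
- by move=> _ _ /(_ I).
- move=> i j s n ti ai ra _ bj qb /(_ I) nb m1; have [bs _ _ _ _] := tgt_props ti.
  have [nl|ln] := leqP (n + 4) (8 + l); last first.
    have [rb _ _] := qb; apply: (match_near_longrun m m' bs b0 h).
    by apply: (isrunW _ rb); lia.
  have h' : near basev (n.+1 + (5 + l - n).+2) (sh 1 b) (sh 1 b') by apply: nearW h; lia.
  have [qb' h1] := near_qpat h' qb; rewrite !shD (_ : 1 + n.+3 = n + 4) in h1; last lia.
  have nb' : b' (n + 4) <> ga.
    move=> e; apply: nb; apply: (@near_ga_next basev (4 + l - n) _ b' b _ e).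
    by apply: near_sym; apply: nearW h1; lia.
  have := m' => /match_step[].
  + by move=> _ _ /(_ I) w'; case: w'; right; rewrite -b0 bj; exists i, s, n.
  + move=> i' j' s' n' ti' ai' ra' _ bj' q' nb1 m1'.
    have [[nn] ss] := qpat_uniq qb' q'; rewrite -nn in ra' m1'.
    have jj : j' = j by rewrite -bj' -b0.
    rewrite jj -ss in ti'; have ii := tg_inj ti ti'.
    apply: (@near_cat _ _ _ _ _ _ n.+4).
      by apply: garun_agree ra ra'; rewrite ai ai' ii.
    rewrite addn4 in m1 m1' h1; apply: (transfers_tail (m := 5 + l - n) (n := n.+3) IH m1 m1') => //.
    by lia.
  + move=> i' j' s' ti' _ _ _ r'; have [_ e _] := qb'.
    by case: (@i0L s'); rewrite -e (r' n.+2).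
  + move=> i' j' s' n' ti' _ _ _ q' nb1 _.
    by have [[nn] _] := qpat_uniq qb' q'; case: nb'; rewrite nn.
  + by move=> i' j' s' _ _ _ _ r' _; case: (garun_L bs (qpat_head qb')).
- move=> i j s ti _ _ _ r; have [bs _ _ _ _] := tgt_props ti.
  exact: (match_near_longrun m m' bs b0 h).
- move=> i j s n ti aj qa bj qb nb m1; have [bs _ _ _ _] := tgt_props ti.
  have [nl|ln] := leqP (n + 4) (8 + l); last first.
    have [rb _ _] := qb; apply: (match_near_longrun m m' bs b0 h).
    by apply: (isrunW _ rb); lia.
  have h' : near basev (n.+1 + (5 + l - n).+2) (sh 1 b) (sh 1 b') by apply: nearW h; lia.
  have [qb' h1] := near_qpat h' qb; rewrite !shD (_ : 1 + n.+3 = n + 4) in h1; last lia.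
  have h2 : near basev (4 + l - n).+1 (sh (n + 4) b) (sh (n + 4) b') by apply: nearW h1; lia.
  have nb' := near_ga_next h2 nb.
  have := m' => /match_step[].
  + by move=> _ _ /(_ I) w'; case: w'; right; rewrite -b0 bj; exists i, s, n.
  + move=> i' j' s' n' ti' _ _ _ _ q' /(_ I) nb1 _.
    by have [[nn] _] := qpat_uniq qb' q'; case: nb1; rewrite -nn.
  + move=> i' j' s' ti' _ _ _ r'; have [_ e _] := qb'.
    by case: (@i0L s'); rewrite -e (r' n.+2).
  + move=> i' j' s' n' ti' aj' qa' bj' q' _ m1'.
    have [[nn] ss] := qpat_uniq qb' q'; rewrite -nn -ss in qa' m1'.
    have jj : j' = j by rewrite -bj' -b0.
    apply: (@near_cat _ _ _ _ _ _ (n + 5)).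
      move=> k kn; apply: (boundary_agree (n := n.+1) _ qa qa'); last by lia.
      by rewrite aj aj' jj.
    have := transfers_tail (m := 4 + l - n) (n := n + 4) IH m1 m1'; rewrite -addnS; apply; first lia.
    have [|_ h3] := @near_garun _ 1 (4 + l - n) _ _ h2.
      by case=> // _; rewrite /sh addn0.
    by move: h3; rewrite !shD -addnA.
  + by move=> i' j' s' _ _ _ _ r' _; case: (garun_L bs (qpat_head qb')).
- move=> i j s ti aj qa bi rb m1; have [bs _ _ _ _] := tgt_props ti.
  have h' : near basev (3 + (5 + l)) (sh 1 b) (sh 1 b') by apply: nearW h; lia.
  have [rb' h1] := near_garun h' rb; rewrite !shD in h1.
  have := m' => /match_step[].
  + by move=> _ _ /(_ I) w'; case: w'; left; rewrite -b0 bi ti.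
  + move=> i' j' s' n' ti' _ _ _ _ q' _ _; have [bs' _ _ _ _] := tgt_props ti'.
    by case: (garun_L bs' (qpat_head q')).
  + move=> i' j' s' ti' _ _ _ r'; have [bs' _ _ _ _] := tgt_props ti'.
    by case: (@garun_L _ _ bs' (r' 1 0 isT)).
  + move=> i' j' s' n' ti' _ _ _ q' _ _; have [bs' _ _ _ _] := tgt_props ti'.
    by case: (garun_L bs' (qpat_head q')).
  + move=> i' j' s' ti' aj' qa' bi' rb1 m1'.
    have ii : i' = i by rewrite -bi' -b0.
    move: ti'; rewrite ii ti => -[jj ss]; rewrite -ss in qa'.
    apply: (@near_cat _ _ _ _ _ _ 4).
      by apply: (boundary_agree _ qa qa'); rewrite aj aj' jj.
    by apply: (transfers_tail (m := 5 + l) (n := 3) IH m1 m1') => //; lia.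
Qed.

Lemma match_near_inv n a a' b b' : M a b -> M a' b' -> near basev (8 + n) b b' -> near anyv n a a'.
Proof.
move: n a a' b b'.
suff H l : transfers basev anyv l (fun _ b => b) (fun a _ => a).
  by move=> n a a' b b'; apply: (H n).
elim: l => [|l IH] k a a' b b'; first by rewrite leqn0 => /eqP ->.
rewrite leq_eqVlt => /orP[/eqP ->|]; last by rewrite ltnS; apply: IH.
move=> m m'; rewrite addnS => h; have := h => /near_step'[[b0 h1]|[ne [t [u [bt bu e ra rb]]]]].
  have [w|nw] := pselect (window (b 0) (sh 1 b)); first exact: match_near_window_inv h1 w.
  have [w|nw'] := pselect (window (b' 0) (sh 1 b')).
    exact: near_sym (match_near_window_inv IH m' m (esym b0) (near_sym h1) w).
  (* The code j l^oo shows no window although it comes from [Top]; it counts as a run that outlasts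
     every level. *)
  have w0 c d : M c d -> ~ window (d 0) (sh 1 d) ->
    (c 0 = d 0 /\ M (sh 1 c) (sh 1 d)) \/ exists2 s, basev s & forall n, isrun n (L s) (sh 1 d).
    move=> /match_step[]; first by left.
    + by move=> i j s n' ti ci _ _ dj q _ _; case; right; exists i, s, n'; rewrite dj.
    + by move=> i j s ti ci _ _ r; right; exists s => //; have [] := tgt_props ti.
    + by move=> i j s n' ti ci _ dj q _ _; case; right; exists i, s, n'; rewrite dj.
    + by move=> i j s ti ci _ di r _; case; left; rewrite di ti.
  case: (w0 _ _ m nw) => [[a0 m1]|[s bs r]]; last exact: (match_near_longrun m m' bs b0 h1).
  case: (w0 _ _ m' nw') => [[a0' m1']|[s bs r]]; last first.
    by apply: near_sym; apply: (match_near_longrun m' m bs (esym b0) _ (r _)); apply: near_sym.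
  left; split; first by rewrite a0 a0'.
  exact: IH h1.
apply: (@match_near_vertices_inv l.+1 a b a' b' t u m m' bt bu e);
  apply: isrunW; [|by apply/runsE; exact: ra| |by apply/runsE; exact: rb]; lia.
Qed.

Lemma coarse_attached : coarse (near anyv) (near basev) 8 M.
Proof.
split; [exact: match_total|exact: match_onto|..] => n a a' b b' m m'.
- exact: match_near.
- exact: match_near_inv.
Qed.

End Rewriting.

Local Open Scope classical_set_scope.
Local Open Scope ring_scope.

(** * Barycentric coordinates and cells *)

(* Barycentric coordinates.  On them the cell of [j] is the orthant [sc j <= bc],
   and distances near a common vertex of two cells become linear. *)
Definition bc (t : vtx) (p : pt) : R :=
  match t with
  | VA => 1 - p.1 - p.2 / Num.sqrt 3
  | VB => p.1 - p.2 / Num.sqrt 3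
  | VG => 2 * p.2 / Num.sqrt 3
  end.

Definition wv (t : vtx) : pt :=
  match t with VA => w_alpha | VB => w_beta | VG => w_gamma end.

Definition vtx_eq (t u : vtx) : bool :=
  match t, u with VA, VA | VB, VB | VG, VG => true | _, _ => false end.

Lemma sqrt3_gt0 : 0 < Num.sqrt 3 :> R. Proof. by rewrite sqrtr_gt0. Qed.

Lemma sqrt3_neq0 : Num.sqrt 3 != 0 :> R. Proof. exact: lt0r_neq0 sqrt3_gt0. Qed.

Lemma vtx_eqP t u : reflect (t = u) (vtx_eq t u).
Proof. by case: t; case: u; constructor. Qed.

Lemma vtx_eqxx t : vtx_eq t t = true. Proof. by case: t. Qed.

Lemma bc_sum p : bc VA p + bc VB p + bc VG p = 1.
Proof. rewrite /bc; ring. Qed.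

Lemma bc_wv t u : bc t (wv u) = (vtx_eq t u)%:R.
Proof.
have s3 := sqrt3_neq0.
case: t; case: u; rewrite /bc /wv /w_alpha /w_beta /w_gamma /=; field => //.
Qed.

Lemma bc_inj p q : (forall t, bc t p = bc t q) -> p = q.
Proof.
case: p => p1 p2; case: q => q1 q2 e; have := e VB; have := e VG; rewrite /bc /= => eG eB.
have s3 := sqrt3_neq0.
have e2 : p2 = q2.
  have -> : p2 = (2 * p2 / Num.sqrt 3) * (Num.sqrt 3 / 2) by field.
  by rewrite eG; field.
by move: eB; rewrite e2 => /addIr ->.
Qed.

Lemma bc_surj (x : vtx -> R) : x VA + x VB + x VG = 1 -> exists p, forall t, bc t p = x t.
Proof.
move=> e; exists (x VB + x VG / 2, x VG * Num.sqrt 3 / 2) => t; have s3 := sqrt3_neq0.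
have e' : x VA = 1 - x VB - x VG by rewrite -e; ring.
by case: t; rewrite /bc /= ?e'; field.
Qed.

Lemma Delta_bc p : Delta p <-> forall t, 0 <= bc t p.
Proof.
split=> [[a [b [c [a0 b0 c0 e ->]]]] t|h].
  have s3 := sqrt3_neq0.
  case: t; rewrite /bc /w_alpha /w_beta /w_gamma /=.
  - by have -> : 1 - (a * 0 + b * 1 + c / 2) - (a * 0 + b * 0 + c * (Num.sqrt 3 / 2)) / Num.sqrt 3 = a;
      [rewrite [RHS](_ : a = 1 - b - c); [field|rewrite -e; ring]|].
  - by have -> : a * 0 + b * 1 + c / 2 - (a * 0 + b * 0 + c * (Num.sqrt 3 / 2)) / Num.sqrt 3 = b;
      [field|].
  - by have -> : 2 * (a * 0 + b * 0 + c * (Num.sqrt 3 / 2)) / Num.sqrt 3 = c; [field|].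
exists (bc VA p), (bc VB p), (bc VG p); split=> //; first exact: bc_sum.
case: p {h} => x y; have s3 := sqrt3_neq0; rewrite /bc /w_alpha /w_beta /w_gamma /=.
by congr (_, _); field.
Qed.

Lemma dist_ge p q t : `|bc t p - bc t q| <= 2 * dist p q.
Proof.
have d1 : `|p.1 - q.1| <= dist p q.
  by rewrite -sqrtr_sqr /dist ler_sqrt ?addr_ge0 ?sqr_ge0 // lerDl sqr_ge0.
have d2 : `|p.2 - q.2| <= dist p q.
  by rewrite -sqrtr_sqr /dist ler_sqrt ?addr_ge0 ?sqr_ge0 // lerDr sqr_ge0.
have s1 : 1 <= Num.sqrt 3 :> R by rewrite -[leLHS]sqrtr1 ler_sqrt; lra.
have d3 : `|(p.2 - q.2) / Num.sqrt 3| <= dist p q.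
  rewrite normrM normfV (ger0_norm (ltW sqrt3_gt0)); apply: le_trans d2.
  by rewrite ler_pdivrMr ?sqrt3_gt0 // ler_peMr.
move: d1 d2 d3; rewrite !ler_norml => /andP[h1 h2] /andP[h3 h4] /andP[h5 h6].
by case: t; rewrite /bc ; move: h5 h6; rewrite mulrBl => h5 h6; apply/andP; split; lra.
Qed.

Lemma dist_le p q e : (forall t, `|bc t p - bc t q| <= e) -> dist p q <= 4 * e.
Proof.
move=> h; have s3 := sqrt3_neq0.
have e0 : 0 <= e by apply: le_trans (h VA).
have s2 : Num.sqrt 3 <= 2 :> R.
  by rewrite -[leRHS]ger0_norm // -sqrtr_sqr ler_sqrt; lra.
have d2 : `|p.2 - q.2| <= e.
  have -> : p.2 - q.2 = (bc VG p - bc VG q) * (Num.sqrt 3 / 2) by rewrite /bc; field.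
  rewrite normrM (@ger0_norm _ (Num.sqrt 3 / 2)); last by rewrite divr_ge0 // sqrtr_ge0.
  apply: le_trans (h VG); apply: ler_piMr => //; lra.
have d1 : `|p.1 - q.1| <= 2 * e.
  have -> : p.1 - q.1 = (bc VB p - bc VB q) + (bc VG p - bc VG q) / 2 by rewrite /bc; field.
  move: (h VB) (h VG); rewrite !ler_norml => /andP[h1 h2] /andP[h3 h4].
  by apply/andP; split; lra.
have -> : 4 * e = Num.sqrt ((4 * e) ^+ 2) by rewrite sqrtr_sqr ger0_norm //; lra.
rewrite /dist ler_sqrt ?sqr_ge0 //.
have q1 : (p.1 - q.1) ^+ 2 <= (2 * e) ^+ 2.
  by rewrite -real_normK ?num_real // ler_pXn2r ?nnegrE //; lra.
have q2 : (p.2 - q.2) ^+ 2 <= e ^+ 2.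
  by rewrite -real_normK ?num_real // ler_pXn2r ?nnegrE //; lra.
apply: le_trans (lerD q1 q2) _; have := sqr_ge0 e; nra.
Qed.

Lemma expr_small (h e : R) : 0 <= h < 1 -> 0 < e -> exists n, h ^+ n < e.
Proof.
move=> /andP[h0 h1] e0.
have c : (fun n => h ^+ n) @ \oo --> (0 : R) by apply: cvg_expr; rewrite ger0_norm.
have [n _ /(_ n (leqnn n))] := c _ (nbhsx_ballx (0 : R) e e0).
rewrite /ball /= /ball_ /= sub0r normrN ger0_norm ?exprn_ge0 // => hn.
by exists n.
Qed.

Section Gasket.
Variable S : IFS.
Hypothesis GS : gasket_IFS S.
Implicit Types (i j c : 'I_(N S)) (t u : vtx) (a b : nat -> 'I_(N S)).

Local Notation r := (@ifs_ratio S).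

Definition vert (j : 'I_(N S)) (t : vtx) : pt := phi j (wv t).
Definition fixes (t : vtx) (j : 'I_(N S)) : Prop := phi j (wv t) = wv t.
Definition sc (j : 'I_(N S)) (t : vtx) : R := bc t (phi j (0, 0)) - r j * bc t (0, 0).

Lemma ratio_gt0 j : 0 < r j. Proof. by case: GS => h _ _; case/andP: (h j). Qed.
Lemma ratio_lt1 j : r j < 1. Proof. by case: GS => h _ _; case/andP: (h j). Qed.

Lemma bc_phi t j z : bc t (phi j z) = r j * bc t z + sc j t.
Proof. by rewrite /sc /phi; case: t; rewrite /bc /=; ring. Qed.

Lemma sc_sum j : sc j VA + sc j VB + sc j VG = 1 - r j.
Proof. by have := bc_sum (phi j (wv VA)); rewrite !bc_phi !bc_wv /=; lra. Qed.

Lemma bc_vert t j u : bc t (vert j u) = r j * (vtx_eq t u)%:R + sc j t.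
Proof. by rewrite /vert bc_phi bc_wv. Qed.

Lemma wv_Delta t : Delta (wv t).
Proof. by apply/Delta_bc => u; rewrite bc_wv ler0n. Qed.

Lemma sc_ge0 j t : 0 <= sc j t.
Proof.
case: GS => _ h _; have [u tu] : exists u, vtx_eq t u = false.
  by case: t; [exists VB|exists VA|exists VA].
have /Delta_bc/(_ t) : Delta (vert j u) by apply: (h j); exists (wv u) => //; apply: wv_Delta.
by rewrite bc_vert tu mulr0 add0r.
Qed.

Lemma sc_le j t : sc j t <= 1 - r j.
Proof. have := sc_sum j; have := sc_ge0 j VA; have := sc_ge0 j VB; have := sc_ge0 j VG; case: t; lra. Qed.

Lemma phi_DeltaP j p : (phi j @` Delta) p <-> forall t, sc j t <= bc t p.
Proof.
split=> [[z /Delta_bc zD <-] t|h].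
  by rewrite bc_phi lerDr mulr_ge0 // ltW // ratio_gt0.
have r0 := ratio_gt0 j; have rn := lt0r_neq0 r0.
have [|z zP] := @bc_surj (fun t => (bc t p - sc j t) / r j).
  rewrite -!mulrDl; apply: (canLR (mulfK rn)); have := sc_sum j; have := bc_sum p; lra.
exists z; first by apply/Delta_bc => t; rewrite zP divr_ge0 ?subr_ge0 // ltW.
by apply: bc_inj => t; rewrite bc_phi zP mulrC divfK // subrK.
Qed.

Lemma phi_inj j : injective (phi j).
Proof.
move=> x y e; apply: bc_inj => t; have := bc_phi t j x; rewrite e bc_phi => /addIr.
by move/(mulfI (lt0r_neq0 (ratio_gt0 j))).
Qed.

Lemma vert_inj2 j t u : vert j t = vert j u -> t = u.
Proof.
move=> /phi_inj e; have := bc_wv t u; rewrite -e bc_wv vtx_eqxx.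
by case: vtx_eqP => //= _ /eqP; rewrite oner_eq0.
Qed.

Lemma cells_meet i j p : i <> j -> (forall t, sc i t <= bc t p) -> (forall t, sc j t <= bc t p) ->
  exists t u, p = vert i t /\ p = vert j u.
Proof.
move=> /eqP ij hi hj; case: GS => _ _ h.
have [v [w [vv ww pv pw]]] := h i j ij p (proj2 (phi_DeltaP i p) hi) (proj2 (phi_DeltaP j p) hj).
have vt x : vertices x -> exists t, x = wv t.
  by case=> [[->|->]|->]; [exists VA|exists VB|exists VG].
by have [t et] := vt v vv; have [u eu] := vt w ww; exists t, u; rewrite /vert -et -eu.
Qed.

(* Two triangles sharing the same vertex would overlap. *)
Lemma vert_inj i j t : vert i t = vert j t -> i = j.
Proof.
move=> e; apply: contrapT => ij.
have ri := ratio_gt0 i; have rj := ratio_gt0 j.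
pose d := Num.min (r i) (r j) / 2.
have d0 : 0 < d by rewrite /d divr_gt0 // lt_min ri.
have mi : Num.min (r i) (r j) <= r i by rewrite ge_min lexx.
have mj : Num.min (r i) (r j) <= r j by rewrite ge_min lexx orbT.
have di : d < r i by move: d0; rewrite /d; lra.
have dj : d < r j by move: d0; rewrite /d; lra.
(* Push the common vertex into both cells: coordinate [t] drops by [d], less than either ratio, the
   others gain [d / 2]. This point is no vertex of [i]. *)
have [|p pP] := @bc_surj (fun u => bc u (vert i t) + d / 2 - (if vtx_eq u t then d * 3 / 2 else 0)).
  by have := bc_sum (vert i t); case: (t) => /=; lra.
have hi u : sc i u <= bc u p by rewrite pP bc_vert; case: vtx_eq => /=; lra.
have hj u : sc j u <= bc u p by rewrite pP e bc_vert; case: vtx_eq => /=; lra.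
have [v [w [pv _]]] := cells_meet ij hi hj.
have := pP t; rewrite pv !bc_vert vtx_eqxx; case: (vtx_eq t v) => /=; lra.
Qed.

Lemma fixes_uniq t c d : fixes t c -> fixes t d -> c = d.
Proof. by move=> fc fd; apply: (@vert_inj _ _ t); rewrite /vert fc fd. Qed.

(** On a cell the coordinate [s] can reach 1 only at the vertex [s], because of [sc_le]; so the
    contact joins like vertices and [vert_inj] applies. *)
Lemma fixes_corner s c j u : fixes s c -> vert c s = vert j u -> j = c.
Proof.
move=> fc e; apply: (@vert_inj _ _ s); rewrite e /vert.
have -> : u = s; last by [].
have : bc s (vert j u) = 1 by rewrite -e /vert fc bc_wv vtx_eqxx.
rewrite bc_vert; case: (vtx_eqP s u) => [->//|_] /=.
have := sc_le j s; have := ratio_gt0 j => r0 sl e1; exfalso; clear e; lra.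
Qed.

Lemma fixes_sc s c u : fixes s c -> u <> s -> sc c u = 0.
Proof.
move=> fc us; have := bc_vert u c s; rewrite /vert fc bc_wv.
by case: (vtx_eqP u s) => [/us []|_] /=; lra.
Qed.

Lemma nfixes_gap s c : ~ fixes s c -> sc c s < 1 - r c.
Proof.
move=> nf; rewrite lt_neqAle sc_le andbT; apply/negP => /eqP e; apply: nf.
have h := sc_sum c; have h1 := sc_ge0 c VA; have h2 := sc_ge0 c VB; have h3 := sc_ge0 c VG.
apply: bc_inj => u; rewrite bc_phi bc_wv.
by move: e; case: (s) => e; case: (u) => /=; lra.
Qed.

(** Two orthants meet in the orthant over the maxima of their corners, which has points of
    barycentric sum 1 once these maxima sum to at most 1. A larger sum measures separation. *)
Lemma vert_touch i j : i <> j -> (exists t u, vert i t = vert j u) \/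
  1 < Num.max (sc i VA) (sc j VA) + Num.max (sc i VB) (sc j VB) + Num.max (sc i VG) (sc j VG).
Proof.
move=> ij; set m := fun t => Num.max (sc i t) (sc j t).
have [h|] := leP (m VA + m VB + m VG) 1; last by right.
left; have [|p pP] := @bc_surj (fun t => m t + (1 - (m VA + m VB + m VG)) / 3); first lra.
have mi t : sc i t <= m t by rewrite /m le_max lexx.
have mj t : sc j t <= m t by rewrite /m le_max lexx orbT.
have [||t [u [e1 e2]]] := @cells_meet i j p ij.
- by move=> t; rewrite pP; have := mi t; lra.
- by move=> t; rewrite pP; have := mj t; lra.
by exists t, u; rewrite -e1.
Qed.

(** * Codes of points and distances *)

Fixpoint incell n (a : nat -> 'I_(N S)) (x : pt) : Prop :=
  if n is m.+1 then exists2 z, x = phi (a 0%N) z & incell m (sh 1 a) z else Delta x.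

Definition code (a : nat -> 'I_(N S)) (x : pt) : Prop := forall n, incell n a x.

Lemma code_tail a x : code a x -> exists2 z, x = phi (a 0%N) z & code (sh 1 a) z.
Proof.
move=> h; have [z e _] := h 1%N; exists z => // n.
by have [z' e' h'] := h n.+1; have -> : z = z' by apply: (@phi_inj (a 0%N)); rewrite -e -e'.
Qed.

(** Cells of all levels are again orthants, hence closed under limits. *)
Lemma incell_bc n a : exists s : vtx -> R, forall x, incell n a x <-> forall t, s t <= bc t x.
Proof.
elim: n a => [|n IH] a; first by exists (fun=> 0) => x; apply: Delta_bc.
have [s sP] := IH (sh 1 a); set j := a 0%N; have r0 := ratio_gt0 j; have rn := lt0r_neq0 r0.
exists (fun t => r j * s t + sc j t) => x; split=> [[z -> /sP h] t|h].
  by rewrite bc_phi lerD2r ler_pM2l.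
have [|z zP] := @bc_surj (fun t => (bc t x - sc j t) / r j).
  rewrite -!mulrDl; apply: (canLR (mulfK rn)); have := sc_sum j; have := bc_sum x; lra.
exists z; last by apply/sP => t; rewrite zP ler_pdivlMr // lerBrDr mulrC.
by apply: bc_inj => t; rewrite bc_phi zP mulrC divfK // subrK.
Qed.

Lemma incell_wv n a t : runs fixes n t a -> incell n a (wv t).
Proof.
elim: n a => [|n IH] a h; first exact: wv_Delta.
exists (wv t); first by rewrite (h 0%N).
by apply: IH => k kn; apply: h.
Qed.

Lemma bc_Delta t z : Delta z -> 0 <= bc t z <= 1.
Proof.
move/Delta_bc => h; rewrite h /=.
by have := bc_sum z; have := h VA; have := h VB; have := h VG; case: t; lra.
Qed.

Variables (lo hi : R).
Hypotheses (lo_gt0 : 0 < lo) (hi_lt1 : hi < 1) (lo_le : forall j, lo <= r j) (le_hi : forall j, r j <= hi).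

Lemma incell_diam n a x y t : incell n a x -> incell n a y -> `|bc t x - bc t y| <= hi ^+ n.
Proof.
elim: n a x y => [|n IH] a x y.
  move=> /(@bc_Delta t)/andP[h1 h2] /(@bc_Delta t)/andP[h3 h4].
  by rewrite expr0 ler_norml; apply/andP; split; lra.
move=> [z -> hz] [z' -> hz']; rewrite !bc_phi.
have -> : r (a 0%N) * bc t z + sc (a 0%N) t - (r (a 0%N) * bc t z' + sc (a 0%N) t) =
  r (a 0%N) * (bc t z - bc t z') by ring.
rewrite normrM exprS; apply: ler_pM => //; last exact: IH hz hz'.
by rewrite ger0_norm // ltW // ratio_gt0.
Qed.

Let near := code_near vert fixes anyv.

Lemma code_near_le n a b x y t : code a x -> code b y -> near n a b ->
  `|bc t x - bc t y| <= 2 * hi ^+ n.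
Proof.
elim: n a b x y => [|n IH] a b x y ax By.
  have /(@bc_Delta t)/andP[h1 h2] := ax 0%N; have /(@bc_Delta t)/andP[h3 h4] := By 0%N.
  by move=> _; rewrite expr0 ler_norml; apply/andP; split; lra.
case=> [[e h]|[u [v [_ _ e ra rb]]]].
  have [z -> az] := code_tail ax; have [z' -> bz'] := code_tail By.
  rewrite -e !bc_phi.
  have -> : r (a 0%N) * bc t z + sc (a 0%N) t - (r (a 0%N) * bc t z' + sc (a 0%N) t) =
    r (a 0%N) * (bc t z - bc t z') by ring.
  rewrite normrM exprS mulrCA; apply: ler_pM => //; last exact: IH az bz' h.
  by rewrite ger0_norm // ltW // ratio_gt0.
have hx : incell n.+1 a (vert (a 0%N) u) by exists (wv u) => //; apply: incell_wv.
have hy : incell n.+1 b (vert (a 0%N) u) by rewrite e; exists (wv v) => //; apply: incell_wv.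
have h1 := incell_diam t (ax n.+1) hx; have h2 := incell_diam t hy (By n.+1).
have -> : bc t x - bc t y = (bc t x - bc t (vert (a 0%N) u)) + (bc t (vert (a 0%N) u) - bc t y) by ring.
apply: le_trans (ler_normD _ _) _; lra.
Qed.

Lemma fin_min (I : finType) (f : I -> R) : (forall x, 0 < f x) ->
  exists2 e : R, 0 < e & forall x, e <= f x.
Proof.
move=> h; have : forall s : seq I, exists2 e : R, 0 < e & forall x, x \in s -> e <= f x.
  elim=> [|i s [c c0 cs]]; first by exists 1.
  exists (Num.min c (f i)); first by rewrite lt_min c0 h.
  by move=> k; rewrite inE => /orP[/eqP ->|/cs ck]; rewrite ge_min ?lexx ?orbT // ck.
move=> /(_ (enum I)) [c c0 cs]; exists c => // i; apply: cs; exact: mem_enum.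
Qed.

(** Letters fixing [t] scale the quantity [1 - bc t] by their ratio; the first other letter leaves a
    definite gap by [nfixes_gap]. *)
Lemma corner_gap : exists2 c : R, 0 < c & c <= 1 /\
  forall t m a z, code a z -> ~ runs fixes m t a -> c * lo ^+ m <= 1 - bc t z.
Proof.
pose f (x : 'I_(N S)) t : R := if pselect (fixes t x) then 1 else 1 - r x - sc x t.
have f0 x t : 0 < f x t by rewrite /f; case: pselect => //= h; have := nfixes_gap h; lra.
have [cA cA0 hA] := fin_min (fun x => f0 x VA); have [cB cB0 hB] := fin_min (fun x => f0 x VB).
have [cG cG0 hG] := fin_min (fun x => f0 x VG).
pose c : R := Num.min 1 (Num.min cA (Num.min cB cG)).
have c0 : 0 < c by rewrite !lt_min cA0 cB0 cG0 ltr01.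
have cf x t : c <= f x t.
  by case: t; rewrite /c !ge_min ?(hA, hB, hG) ?orbT.
have c1 : c <= 1 by rewrite /c ge_min lexx.
exists c => //; split=> // t m; elim: m => [|m IH] a z az nr; first by case: nr.
have [z' -> az'] := code_tail az; rewrite bc_phi.
have r0 := ratio_gt0 (a 0%N).
have lo1 : lo <= 1 by have := lo_le (a 0%N); have := ratio_lt1 (a 0%N); lra.
have [ft|nft] := pselect (fixes t (a 0%N)).
  have nr' : ~ runs fixes m t (sh 1 a) by move=> h; apply: nr => -[//|k] kn; apply: h.
  have h := IH _ _ az' nr'.
  have -> : sc (a 0%N) t = 1 - r (a 0%N).
    by have := bc_vert t (a 0%N) t; rewrite /vert ft bc_wv vtx_eqxx /=; lra.
  have -> : 1 - (r (a 0%N) * bc t z' + (1 - r (a 0%N))) = r (a 0%N) * (1 - bc t z') by ring.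
  rewrite exprS mulrCA; apply: ler_pM => //; first exact: ltW.
  by rewrite mulr_ge0 ?exprn_ge0 // ltW.
have := cf (a 0%N) t; rewrite /f; case: pselect => //= _ h.
have /(@bc_Delta t)/andP[_ h2] := az' 0%N.
have h3 : c * lo ^+ m.+1 <= c by apply: ler_piMr; [exact: ltW|apply: exprn_ile1 => //; exact: ltW].
by nra.
Qed.

(** Common letters only scale the picture. At the first difference the cells are disjoint, with
    finitely many pairs to bound, or share a vertex which one of the codes leaves early enough for
    [corner_gap]. *)
Lemma code_far : exists2 c : R, 0 < c & forall n a b x y, code a x -> code b y -> ~ near n a b ->
  exists t, c * lo ^+ n <= `|bc t x - bc t y|.
Proof.
have [c1 c10 [c11 gap]] := corner_gap.
pose m i j t : R := Num.max (sc i t) (sc j t).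
(* A third of the excess in [vert_touch]; pairs without excess get the neutral value 1. *)
pose f (p : 'I_(N S) * 'I_(N S)) : R := let d := m p.1 p.2 VA + m p.1 p.2 VB + m p.1 p.2 VG - 1 in
  if 0 < d then d / 3 else 1.
have f0 p : 0 < f p by rewrite /f; case: ifP => // ?; rewrite divr_gt0.
have [c2 c20 sep] := fin_min f0.
pose c : R := Num.min c1 c2.
have c0 : 0 < c by rewrite lt_min c10.
have cc1 : c <= c1 by rewrite ge_min lexx.
have cc2 : c <= c2 by rewrite ge_min lexx orbT.
exists c => //; elim=> [|n IH] a b x y ax By nn; first by case: nn.
set i := a 0%N; set j := b 0%N; have ri := ratio_gt0 i; have rj := ratio_gt0 j.
have lo1 : lo <= 1 by have := lo_le i; have := ratio_lt1 i; lra.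
have [z xz az] := code_tail ax; have [z' yz bz] := code_tail By.
have [e|ij] := pselect (i = j).
  have nn' : ~ near n (sh 1 a) (sh 1 b) by move=> h; apply: nn; left.
  have [t h] := IH _ _ _ _ az bz nn'; exists t.
  rewrite xz yz -/i -/j -e !bc_phi.
  have -> : r i * bc t z + sc i t - (r i * bc t z' + sc i t) = r i * (bc t z - bc t z') by ring.
  rewrite normrM (gtr0_norm ri) exprS mulrCA; apply: ler_pM => //; first exact: ltW.
  by rewrite mulr_ge0 ?exprn_ge0 // ltW.
have zD t := bc_Delta t (az 0%N); have zD' t := bc_Delta t (bz 0%N).
have [[t [u e]]|big] := vert_touch ij.
  have tu : vtx_eq t u = false by case: vtx_eqP => // tu; case: ij; apply: (@vert_inj _ _ t); rewrite {2}tu.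
  have ut : vtx_eq u t = false by clear -tu; case: t u tu => -[].
  have et : r i + sc i t = sc j t.
    by have := congr1 (bc t) e; rewrite !bc_vert vtx_eqxx tu /=; lra.
  have eu : sc i u = r j + sc j u.
    by have := congr1 (bc u) e; rewrite !bc_vert vtx_eqxx ut /=; lra.
  have [na|nb] : ~ runs fixes n t (sh 1 a) \/ ~ runs fixes n u (sh 1 b).
    have [ha|] := pselect (runs fixes n t (sh 1 a)); last by left.
    have [hb|] := pselect (runs fixes n u (sh 1 b)); last by right.
    by case: nn; right; exists t, u.
  (* [sc j t] bounds coordinate [t] from above on the cell of [i] and from below on that of [j], so
     the gap of [x] survives the subtraction. *)
  - exists t; have h := gap _ _ _ _ az na; rewrite xz yz -/i -/j !bc_phi.
    rewrite ler_normr; apply/orP; right.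
    have h1 : c * lo ^+ n.+1 <= r i * (1 - bc t z).
      rewrite exprS mulrCA; apply: ler_pM => //; first exact: ltW.
      + by rewrite mulr_ge0 ?exprn_ge0 // ltW.
      + by apply: le_trans h; apply: ler_wpM2r => //; rewrite exprn_ge0 // ltW.
    have /andP[h2 _] := zD' t; have h3 : 0 <= r j * bc t z' by rewrite mulr_ge0 // ltW.
    by move: h1 h3 et; clear; lra.
  - exists u; have h := gap _ _ _ _ bz nb; rewrite xz yz -/i -/j !bc_phi.
    rewrite ler_normr; apply/orP; left.
    have h1 : c * lo ^+ n.+1 <= r j * (1 - bc u z').
      rewrite exprS mulrCA; apply: ler_pM => //; first exact: ltW.
      + by rewrite mulr_ge0 ?exprn_ge0 // ltW.
      + by apply: le_trans h; apply: ler_wpM2r => //; rewrite exprn_ge0 // ltW.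
    have /andP[h2 _] := zD u; have h3 : 0 <= r i * bc u z by rewrite mulr_ge0 // ltW.
    by move: h1 h3 eu; clear; lra.
have := sep (i, j); rewrite /f /= subr_gt0 big => hc2.
have h3 : c * lo ^+ n.+1 <= c2.
  apply: le_trans cc2; apply: ler_piMr; [exact: ltW|apply: exprn_ile1 => //; exact: ltW].
(* With all coordinates closer than [c2], both corners would lie below [bc t x + c2]; summing over
   [t] contradicts the excess. *)
apply: contrapT => /forallNP hn; have hlt t : `|bc t x - bc t y| < c2.
  by apply: lt_le_trans h3; rewrite ltNge; apply/negP.
have bx t : sc i t <= bc t x by rewrite xz bc_phi -/i lerDr; apply: mulr_ge0; [exact: ltW|case/andP: (zD t)].
have by_ t : sc j t <= bc t y by rewrite yz bc_phi -/j lerDr; apply: mulr_ge0; [exact: ltW|case/andP: (zD' t)].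
have mx t : m i j t < bc t x + c2.
  have := hlt t; rewrite ltr_norml => /andP[h1 h2]; rewrite /m gt_max; apply/andP; split.
  - have := bx t; lra.
  - have := by_ t; lra.
have h4 := mx VA; have h5 := mx VB; have h6 := mx VG; have h7 := bc_sum x.
move: hc2 h4 h5 h6 h7. rewrite /m; clear xz yz; lra.
Qed.

(** * Attractors and their codes *)

Section Attractor.
Variable K : set pt.
Hypothesis KA : is_attractor S K.

Lemma attractor_phi j x : K x -> K (phi j x).
Proof. by case: KA => _ _ e Kx; rewrite e; exists j => //; exists x. Qed.

Lemma attractor_pre x : K x -> exists jy : 'I_(N S) * pt, K jy.2 /\ x = phi jy.1 jy.2.
Proof. by case: KA => _ _ e; rewrite {1}e => -[j _ [y Ky <-]]; exists (j, y). Qed.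

(** Compactness bounds [- bc t] on [K], and each map shrinks this bound by [hi] since [sc] is
    nonnegative; iteration brings it to 0. *)
Lemma attractor_Delta x : K x -> Delta x.
Proof.
move=> Kx; apply/Delta_bc => t.
have [B BP] : exists B : R, forall x, K x -> - bc t x <= B.
  case: KA => _ cK _; have [M [Mr MP]] := @compact_bounded R [the normedModType R of (R^o * R^o)%type] K cK.
  exists (1 + 3 * (M + 1)) => {}x {}Kx.
  have : `|x : (R^o * R^o)%type| <= M + 1 by apply: (MP (M + 1)) => //; rewrite ltrDl.
  rewrite prod_normE ge_max => /andP[h1 h2].
  have s1 : 1 <= Num.sqrt 3 :> R by rewrite -[leLHS]sqrtr1 ler_sqrt; lra.
  have h3 : `|x.2 / Num.sqrt 3| <= M + 1.
    rewrite normrM normfV (ger0_norm (ltW sqrt3_gt0)); apply: le_trans h2.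
    by rewrite ler_pdivrMr ?sqrt3_gt0 // ler_peMr.
  move: h1 h3; rewrite !ler_norml => /andP[h1 h1'] /andP[h3 h3'].
  by case: t; rewrite /bc -?mulrA; lra.
have step n : forall y, K y -> - bc t y <= hi ^+ n * Num.max B 0.
  elim: n => [|n IH] y Ky; first by rewrite expr0 mul1r le_max BP.
  have [[j z] /= [Kz ->]] := attractor_pre Ky; rewrite bc_phi.
  have h1 := IH z Kz; have h2 := sc_ge0 j t; have r0 := ratio_gt0 j; have rh := le_hi j.
  have h3 : 0 <= hi ^+ n * Num.max B 0.
    by rewrite mulr_ge0 ?exprn_ge0 ?le_max ?lexx ?orbT //; lra.
  rewrite exprS -mulrA; nra.
have Bm : 0 <= Num.max B 0 by rewrite le_max lexx orbT.
rewrite leNgt; apply/negP => x0.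
have h0 : 0 < hi by case: KA => -[y /attractor_pre[[j _] _]] _ _; have := ratio_gt0 j; have := le_hi j; lra.
have M1 : 0 < Num.max B 0 + 1 by apply: ltr_pwDr.
have [||n hn] := @expr_small hi (- bc t x / (Num.max B 0 + 1)); first by rewrite ltW.
  by rewrite divr_gt0 // oppr_gt0.
have := step n x Kx; rewrite leNgt => /negP; apply.
move: hn; rewrite ltr_pdivlMr // mulrDr mulr1; apply: le_lt_trans.
by rewrite lerDl exprn_ge0 // ltW.
Qed.

Lemma code_of_point x : K x -> exists a, code a x.
Proof.
move=> Kx; have pre (z : {z | K z}) : exists jy : 'I_(N S) * {z | K z}, sval z = phi jy.1 (sval jy.2).
  by case: z => z /[dup] Kz /attractor_pre[[j y] /= [Ky e]]; exists (j, exist _ y Ky).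
have [f fP] := boolp.choice pre.
pose a z n := (f (iter n (fun z => (f z).2) z)).1.
exists (a (exist _ x Kx)) => n; rewrite -[x in incell _ _ x]/(sval (exist _ x Kx)).
move: (exist _ x Kx); elim: n => [|n IH] z; first by apply: attractor_Delta; apply: (svalP z).
exists (sval (f z).2); first exact: fP.
by have -> : sh 1 (a z) = a (f z).2; [apply/funext => k; rewrite /sh /a add1n iterSr|exact: IH].
Qed.

(** A cluster point of the images of [x0] under the first [n] maps lies in every cell, since cells
    are closed. *)
Lemma point_of_code a : exists2 x, K x & code a x.
Proof.
case: KA => -[x0 Kx0] cK _.
pose F n := (fix F n (a : nat -> 'I_(N S)) : pt := if n is m.+1 then phi (a 0%N) (F m (sh 1 a)) else x0) n.
have KF n b : K (F n b) by elim: n b => [//|n IH] b; apply: attractor_phi.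
have cF m n b : (m <= n)%N -> incell m b (F n b).
  elim: m n b => [|m IH] [|n] b mn //; try by apply: attractor_Delta; apply: KF.
  by exists (F n (sh 1 b)) => //; apply: IH.
have [] := cK ((fun n => F n a) @ \oo)%classic.
  by exists 0%N => // n _; apply: KF.
move=> x [Kx cx]; exists x => // n; have [s sP] := incell_bc n a.
apply/sP => t; rewrite leNgt; apply/negP => lt.
pose e := (s t - bc t x) / 4; have e0 : 0 < e by rewrite /e; lra.
have [||y [[k nk yk] By]] := cx (fun y => exists2 k, (n <= k)%N & y = F k a) (ball x e).
- by exists n => // k /= nk; exists k.
- exact: nbhsx_ballx.
have yc : incell n a y by rewrite yk; apply: cF nk.
have h1 := proj1 (sP y) yc t.
case: By; rewrite /ball /= /ball_ /=.
have s1 : 1 <= Num.sqrt 3 :> R by rewrite -[leLHS]sqrtr1 ler_sqrt; lra.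
move=> h2 h3; have h4 : `|(x.2 - y.2) / Num.sqrt 3| < e.
  rewrite normrM normfV (ger0_norm (ltW sqrt3_gt0)); apply: le_lt_trans h3.
  by rewrite ler_pdivrMr ?sqrt3_gt0 // ler_peMr.
move: h2 h4; rewrite /= !ltr_norml mulrBl => /andP[h5 h6] /andP[h7 h8].
clear yk; move: lt h1 h5 h6 h7 h8; rewrite /e; case: (t); rewrite /bc -?mulrA; lra.
Qed.

(** The vertex is the only point with the constant code [c]. Thus a letter fixing the top excludes
    the case [~ K w_gamma]. *)
Lemma fixes_in t c : fixes t c -> K (wv t).
Proof.
move=> fc; have [x Kx cx] := point_of_code (fun=> c).
suff -> : wv t = x by [].
apply: bc_inj => u; apply/eqP; rewrite -subr_eq0 -normr_le0 leNgt; apply/negP => lt.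
have h0 : 0 < hi by have := ratio_gt0 c; have := le_hi c; lra.
have [|n hn] := @expr_small hi _ _ lt; first by rewrite ltW.
have := @incell_diam n (fun=> c) (wv t) x u (incell_wv (fun k _ => fc)) (cx n).
by rewrite leNgt hn.
Qed.

Lemma fixes_vtx_uniq t u c : fixes t c -> fixes u c -> t = u.
Proof.
move=> ft fu; apply: contrapT => tu.
have := bc_vert t c t; rewrite /vert ft bc_wv vtx_eqxx (fixes_sc fu tu) => e.
have := ratio_lt1 c; move: e => /=; lra.
Qed.

(** Detaching is necessary only if some top touches a base vertex and some letter fixes the top; the
    latter forces top isolation. *)
Lemma gasket_coarse al be : fixes VA al -> fixes VB be -> top_isolated S K \/ ~ K w_gamma ->
  exists m M, coarse (code_near vert fixes anyv) (code_near vert fixes basev) m M.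
Proof.
move=> fA fB top.
have [[[i1 [j1 [u1 [bu1 e1]]]] [g1 fg1]]|un] := pselect
    ((exists i j u, basev u /\ vert i VG = vert j u) /\ exists g, fixes VG g); last first.
  exists 1%N, eq; apply: coarse_unattached.
  - exact: vert_inj2.
  - exact: vert_inj.
  - exact: fixes_uniq.
  - by move=> i j u c bu e fc; apply: un; split; [exists i, j, u|exists c].
case: top => [[g [[_ fg] isog]]|nG]; last by case: nG; apply: (fixes_in fg1).
have {}fg : fixes VG g by [].
pose L t := match t with VA => al | VB => be | VG => g end.
have fL t : fixes t (L t) by case: t.
have iso j t u : vert (L VG) t = vert j u -> j = L VG.
  move=> e; apply: contrapT => /eqP jg; have := isog j jg.
  move/seteqP => [/(_ (vert g t)) h _]; apply: h; split; first by exists (wv t) => //; apply: wv_Delta.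
  by rewrite [vert g t]e; exists (wv u) => //; apply: wv_Delta.
(* The base cells have height 0, whereas the top of [i] has positive height. *)
have base i u s : basev s -> vert i VG <> vert (L u) s.
  move=> bs e; have [uG|uG] := pselect (u = VG).
    by subst u; have ig := iso _ _ _ (esym e); subst i; apply: bs; rewrite (vert_inj2 e).
  have := congr1 (bc VG) e; rewrite !bc_vert vtx_eqxx (fixes_sc (fL u)); last by move=> h; apply: uG.
  have -> : vtx_eq VG s = false by case: (s) bs.
  have := ratio_gt0 i; have := sc_ge0 i VG; rewrite /=; clear e; lra.
have tgE i : exists o : option ('I_(N S) * vtx), match o with
    | Some (j, s) => basev s /\ vert i VG = vert j s
    | None => forall j s, basev s -> vert i VG <> vert j s end.
  have [[j [s h]]|h] := pselect (exists j s, basev s /\ vert i VG = vert j s); first by exists (Some (j, s)).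
  by exists None => j s bs e; apply: h; exists j, s.
have [tg tgP] := boolp.choice tgE.
pose att j := `[< exists i u, basev u /\ vert i VG = vert j u >].
have att1 : att j1 by apply/asboolP; exists i1, u1.
(* [i0] is a highest cell among those carrying a top at their base: a cell resting on it would be
   higher and of the same sort. *)
case: (arg_maxP (fun j => sc j VG) att1) => i0 /asboolP[i2 [u2 [bu2 e2]]] i0max.
have up i j u : basev u -> vert i VG = vert j u -> sc i VG < sc j VG.
  move=> bu e; have := congr1 (bc VG) e; rewrite !bc_vert vtx_eqxx.
  have -> : vtx_eq VG u = false by case: (u) bu.
  have := ratio_gt0 i; rewrite /=; clear e; lra.
exists 8%N, (matched L i0 tg True True); apply: (coarse_attached (V := vert)).
- exact: vert_inj2.
- exact: vert_inj.
- by move=> t c; split=> [fc|->]; [exact: fixes_uniq fc (fL t)|exact: fL].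
- by move=> t u e; apply: (@fixes_vtx_uniq _ _ (L t)); [|rewrite e].
- exact: iso.
- by move=> s j u; apply: fixes_corner.
- exact: base.
- by move=> t i0t; apply: (base i2 t u2 bu2); rewrite -i0t.
- move=> j s bs e; have h := up _ _ _ bs e.
  have : att j by apply/asboolP; exists i0, s.
  by move=> aj; have := i0max _ aj; rewrite /= leNgt h.
- by move=> i j s ti; have := tgP i; rewrite ti.
- by move=> i j s ti; have := tgP i; rewrite ti; apply.
Qed.

End Attractor.

End Gasket.

(** * Horizontal blocks *)

Definition hadj (S : IFS) (i j : 'I_(N S)) : bool := phi i w_beta == phi j w_alpha.

Section Blocks.
Local Open Scope nat_scope.
Variable S : IFS.
Hypothesis GS : gasket_IFS S.
Implicit Types (i j : 'I_(N S)) (I J : {set 'I_(N S)}) (s : seq 'I_(N S)).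
Local Notation adj := (@hadj S).

Lemma hadj_vert i j : adj i j <-> vert i VB = vert j VA.
Proof. by split=> [/eqP|e]; [|apply/eqP]. Qed.

Lemma hadj_inj i i' j j' : adj i j -> adj i' j' -> (i = i' <-> j = j').
Proof.
move=> /hadj_vert e /hadj_vert e'; split=> h; subst.
- by apply: (vert_inj GS (t := VA)); rewrite -e -e'.
- by apply: (vert_inj GS (t := VB)); rewrite e e'.
Qed.

Lemma hadj_lt i j : adj i j -> (sc i VB < sc j VB)%R.
Proof.
move=> /hadj_vert /(congr1 (bc VB)); rewrite !bc_vert /= mulr1 mulr0 add0r => <-.
by rewrite ltrDr ratio_gt0.
Qed.

Lemma sorted_lt s x0 k l : sorted adj s -> k < l -> l < size s ->
  (sc (nth x0 s k) VB < sc (nth x0 s l) VB)%R.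
Proof.
move=> /(sortedP x0) h; elim: l => [//|l IH]; rewrite ltnS leq_eqVlt => /orP[/eqP ->|kl] ls.
  exact: hadj_lt (h l ls).
by apply: lt_trans (IH kl (ltnW ls)) (hadj_lt (h l ls)).
Qed.

Lemma hchain_set s : s != [::] -> uniq s -> sorted adj s -> hchain [set x in s].
Proof. by move=> s0 us ss; exists s. Qed.

Lemma hblock_exists i : exists2 I, hblock I & i \in I.
Proof.
have h0 : `[< hchain [set i] >] by apply/asboolP; exists [:: i]; split=> //; apply/setP => x; rewrite !inE.
have [I /maxsetP[/asboolP cI mI] iI] := maxset_exists (P := fun I => `[< hchain I >]) h0.
exists I; last by apply: (fintype.subsetP iI); rewrite inE.
by split=> // J cJ IJ; rewrite (mI J) //; apply/asboolP.
Qed.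

Lemma sorted_rcons_last s i j : i \in s -> (index i s).+1 = size s -> sorted adj s ->
  adj i j -> sorted adj (rcons s j).
Proof.
case: s => // x p is_ ilast /= pp ij; rewrite rcons_path pp /=; suff -> : last x p = i by [].
by rewrite (last_nth i) -[RHS](nth_index i is_); move: ilast => /= -[->].
Qed.

Lemma sorted_cons_first s i j : i \in s -> index i s = 0 -> sorted adj s ->
  adj j i -> sorted adj (j :: s).
Proof. by case: s => //= x p is_; case: eqP => [-> _ -> ->|]. Qed.

Variables (I : {set 'I_(N S)}) (s : seq 'I_(N S)).
Hypotheses (bI : hblock I) (Is : I = [set x in s]) (us : uniq s) (ss : sorted adj s).

Lemma mem_block i : (i \in I) = (i \in s). Proof. by rewrite Is inE. Qed.

Lemma card_block : #|I| = size s.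
Proof. by rewrite Is cardsE; apply/card_uniqP. Qed.

Lemma block_maximal s' : s' != [::] -> uniq s' -> sorted adj s' -> {subset s <= s'} -> {subset s' <= s}.
Proof.
move=> s0 us' ss' sub x xs'; rewrite -mem_block; case: bI => _ /(_ [set y in s']) -> //.
- by rewrite inE.
- exact: hchain_set.
- by apply/fintype.subsetP => y; rewrite Is !inE => /sub.
Qed.

(** A right neighbour of the last letter could be appended, against maximality; it is not already in
    [s], because adjacency moves strictly to the right. *)
Lemma index_next i j : i \in s -> adj i j -> j \in s /\ index j s = (index i s).+1.
Proof.
move=> is_ ij; have [lt|ge] := ltnP (index i s).+1 (size s).
  have := elimT (sortedP i) ss _ lt; rewrite nth_index // => ij'.
  have -> : j = nth i s (index i s).+1 by apply/(hadj_inj ij ij').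
  by rewrite mem_nth // index_uniq.
have ilast : (index i s).+1 = size s by apply/eqP; rewrite eqn_leq ge index_mem is_.
suff js : j \in s.
  have := index_mem j s; rewrite js -ilast ltnS leq_eqVlt => /orP[/eqP e|lt].
    by have := hadj_lt ij; rewrite -(nth_index i js) e nth_index // ltxx.
  have := @sorted_lt s i _ _ ss lt; rewrite index_mem is_ !nth_index // => /(_ isT) h.
  by have := hadj_lt ij; rewrite ltNge (ltW h).
apply/negPn/negP => jn.
have : {subset rcons s j <= s}.
  apply: block_maximal.
  - by case: (s).
  - by rewrite rcons_uniq jn.
  - exact: sorted_rcons_last ij.
  - by move=> x xs; rewrite mem_rcons inE xs orbT.
by move=> /(_ j); rewrite mem_rcons mem_head => /(_ isT); apply/negP.
Qed.

Lemma mem_prev i j : i \in s -> adj j i -> j \in s.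
Proof.
move=> is_ ji; case E: (index i s) => [|k].
  apply/negPn/negP => jn; have : {subset j :: s <= s}.
    apply: block_maximal => //=; first by rewrite jn.
      exact: sorted_cons_first ji.
    by move=> x xs; rewrite inE xs orbT.
  by move=> /(_ j); rewrite mem_head => /(_ isT); apply/negP.
have ks : k.+1 < size s by rewrite -E index_mem.
have := elimT (sortedP i) ss _ ks; rewrite -E nth_index // => ki.
have -> : j = nth i s k by apply/(hadj_inj ji ki).
by rewrite mem_nth // ltnW.
Qed.

Lemma index_adj i j : i \in s -> j \in s -> index j s = (index i s).+1 -> adj i j.
Proof.
move=> is_ js e; have lt : (index i s).+1 < size s by rewrite -e index_mem.
by have := elimT (sortedP i) ss _ lt; rewrite -e !nth_index.
Qed.

Lemma index_first i : i \in s -> fixes VA i -> index i s = 0.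
Proof.
move=> is_ fi; case E: (index i s) => [//|k].
have ks : k.+1 < size s by rewrite -E index_mem.
have := elimT (sortedP i) ss _ ks; rewrite -E nth_index // => /hadj_vert e.
have ki := fixes_corner GS fi (esym e); rewrite ki in e.
by have := vert_inj2 GS e.
Qed.

Lemma index_last i : i \in s -> fixes VB i -> index i s = (size s).-1.
Proof.
move=> is_ fi; have [lt|ge] := ltnP (index i s).+1 (size s).
  have := elimT (sortedP i) ss _ lt; rewrite nth_index // => /hadj_vert e.
  have ki := fixes_corner GS fi e; rewrite ki in e.
  by have := vert_inj2 GS e.
have lt : index i s < size s by rewrite index_mem.
by apply/eqP; rewrite eqn_leq -ltnS prednK ?lt ?(leq_trans _ lt) //= -ltnS prednK ?(leq_trans _ lt).
Qed.

End Blocks.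

(** A block contains all neighbours of its members, so a chain meeting it lies inside it. *)
Lemma hblock_meet (S : IFS) (GS : gasket_IFS S) (I J : {set 'I_(N S)}) i :
  hblock I -> hblock J -> i \in I -> i \in J -> I = J.
Proof.
move=> bI bJ iI iJ; have [[s [s0 us Is ss]] mI] := bI; apply: mI; first by case: bJ.
have [[t [t0 ut Jt st]] _] := bJ.
suff h : {subset s <= t} by apply/fintype.subsetP => x; rewrite Is Jt !inE => /h.
have fwd x y : hadj x y -> x \in t -> y \in t.
  by move=> xy xt; have [] := index_next GS bJ Jt ut st xt xy.
have bwd x y : hadj x y -> y \in t -> x \in t.
  by move=> xy yt; apply: (mem_prev GS bJ Jt ut st yt xy).
have : exists2 x, x \in s & x \in t by exists i; [rewrite Is inE in iI|rewrite Jt inE in iJ].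
clear -ss fwd bwd; case: s ss => [|x p]; first by move=> _ [].
elim: p x => [|y p IH] x /=; first by move=> _ [z]; rewrite inE => /eqP -> xt w; rewrite inE => /eqP ->.
move=> /andP[xy pp] [z]; rewrite inE => zs zt.
have sub : {subset y :: p <= t}.
  apply: IH => //; case/orP: zs => [/eqP zx|zp]; last by exists z.
  by exists y; [exact: mem_head|apply: fwd xy _; rewrite -zx].
move=> w; rewrite inE => /orP[/eqP ->|/sub //].
by apply: bwd xy _; apply: sub; apply: mem_head.
Qed.

Lemma hblock_seq (S : IFS) (I : {set 'I_(N S)}) : exists s : seq 'I_(N S),
  hblock I -> [/\ I = [set x in s], uniq s & sorted (@hadj S) s].
Proof.
have [[[s [_ us Is ss]] _]|nb] := pselect (hblock I); first by exists s.
by exists [::].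
Qed.

Section LetterBijection.
Local Open Scope nat_scope.
Variables SE SF : IFS.
Hypotheses (GE : gasket_IFS SE) (GF : gasket_IFS SF).
Variable h : {set 'I_(N SE)} -> {set 'I_(N SF)}.
Hypotheses (hb : forall I, hblock I -> hblock (h I))
  (hinj : forall I J, hblock I -> hblock J -> h I = h J -> I = J)
  (hsurj : forall J, hblock J -> exists2 I, hblock I & h I = J)
  (hcard : forall I, hblock I -> #|h I| = #|I|).
Variables (I0 : {set 'I_(N SE)}) (al be : 'I_(N SE)) (J0 : {set 'I_(N SF)}) (al' be' : 'I_(N SF)).
Hypotheses (bI0 : hblock I0) (alI : al \in I0) (beI : be \in I0)
  (bJ0 : hblock J0) (alJ : al' \in J0) (beJ : be' \in J0) (hI0 : h I0 = J0).
Hypotheses (fal : fixes VA al) (fbe : fixes VB be) (fal' : fixes VA al') (fbe' : fixes VB be').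

(** The letter at position k of a block goes to the letter at position k of the image block; in the
    common block alpha comes first and beta last. *)
Lemma letter_bijection : exists sg : 'I_(N SE) -> 'I_(N SF),
  [/\ injective sg, (forall y, exists x, sg x = y), (forall i j, hadj i j <-> hadj (sg i) (sg j)),
      sg al = al' & sg be = be'].
Proof.
have exb i : exists I : {set 'I_(N SE)}, hblock I /\ i \in I.
  by have [J bJ iJ] := hblock_exists i; exists J.
have [bl blP] := boolp.choice exb.
have [sq sqP] := boolp.choice (@hblock_seq SE); have [sq' sqP'] := boolp.choice (@hblock_seq SF).
have sqE I : hblock I -> size (sq I) = size (sq' (h I)).
  move=> bI; have [Is us ss] := sqP I bI; have [Is' us' ss'] := sqP' _ (hb bI).
  by rewrite -(card_block Is us) -(card_block Is' us') hcard.
have msq i : i \in sq (bl i).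
  by have [bI iI] := blP i; have [Is us ss] := sqP _ bI; rewrite -(mem_block Is).
pose idx i := index i (sq (bl i)).
pose sg i := nth al' (sq' (h (bl i))) (idx i).
have idx_lt i : idx i < size (sq' (h (bl i))).
  by rewrite -sqE ?index_mem ?msq //; case: (blP i).
have msg i : sg i \in sq' (h (bl i)) by apply: mem_nth.
have isg i : index (sg i) (sq' (h (bl i))) = idx i.
  by have [bI _] := blP i; have [_ us _] := sqP' _ (hb bI); apply: index_uniq.
have msgb i : sg i \in h (bl i).
  by have [bI _] := blP i; have [Is _ _] := sqP' _ (hb bI); rewrite (mem_block Is).
have blE I i : hblock I -> i \in I -> bl i = I.
  by move=> bI iI; have [bI' iI'] := blP i; apply: (hblock_meet GE bI' bI iI' iI).
have bl_sg i j J : hblock J -> sg i \in J -> sg j \in J -> bl i = bl j.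
  move=> bJ iJ jJ; have [bI _] := blP i; have [bI' _] := blP j; apply: hinj => //.
  by rewrite (hblock_meet GF (hb bI) bJ (msgb i) iJ) (hblock_meet GF (hb bI') bJ (msgb j) jJ).
have idx_inj i j : bl i = bl j -> idx i = idx j -> i = j.
  by move=> e ij; rewrite -(nth_index i (msq i)) -(nth_index i (msq j)) -/(idx i) -/(idx j) ij e.
exists sg; split.
- move=> i j e; have e' : bl i = bl j.
    by apply: (bl_sg i j (h (bl i))); [apply: hb; case: (blP i)|exact: msgb|rewrite -e; exact: msgb].
  by apply: idx_inj => //; rewrite -isg -[RHS]isg e e'.
- move=> y; have [J bJ yJ] := hblock_exists y; have [I bI hI] := hsurj bJ.
  have [Js ut st] := sqP' _ bJ; have [Is us ss] := sqP _ bI.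
  have yt : y \in sq' J by rewrite -(mem_block Js).
  have kI : index y (sq' J) < size (sq I) by rewrite (sqE _ bI) hI index_mem.
  pose x := nth al (sq I) (index y (sq' J)); have xI : x \in I by rewrite (mem_block Is) mem_nth.
  exists x; rewrite /sg /idx (blE I x bI xI) hI /x index_uniq // nth_index //.
- move=> i j; have [bI iI] := blP i; have [Is us ss] := sqP _ bI; have [Js ut st] := sqP' _ (hb bI).
  split=> ij.
    have [js je] := index_next GE bI Is us ss (msq i) ij.
    have bij : bl j = bl i by apply: blE => //; rewrite (mem_block Is).
    have mj := msg j; have ij' := isg j; rewrite bij in mj ij'.
    apply: (index_adj st (msg i) mj); rewrite ij' isg /idx bij //.
  have [js je] := index_next GF (hb bI) Js ut st (msg i) ij.
  have bij : bl j = bl i.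
    by apply: (bl_sg j i (h (bl i)) (hb bI)); rewrite (mem_block Js).
  have mj := msq j; rewrite bij in mj.
  apply: (index_adj ss (msq i) mj).
  by rewrite isg in je; rewrite -[X in sq X]bij -/(idx j) -(isg j) bij je.
- have [Is us ss] := sqP _ bI0; have [Js ut st] := sqP' _ bJ0.
  have alb : bl al = I0 by apply: blE.
  have h1 : index al (sq I0) = 0 by apply: (index_first GE ss _ fal); rewrite -(mem_block Is).
  have aj : al' \in sq' J0 by rewrite -(mem_block Js).
  have h2 : index al' (sq' J0) = 0 by apply: (index_first GF st aj fal').
  by rewrite /sg /idx alb hI0 h1 -h2 nth_index.
- have [Is us ss] := sqP _ bI0; have [Js ut st] := sqP' _ bJ0.
  have beb : bl be = I0 by apply: blE.
  have h1 : index be (sq I0) = (size (sq I0)).-1 by apply: (index_last GE ss _ fbe); rewrite -(mem_block Is).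
  have bj : be' \in sq' J0 by rewrite -(mem_block Js).
  have h2 : index be' (sq' J0) = (size (sq' J0)).-1 by apply: (index_last GF st bj fbe').
  by rewrite /sg /idx beb hI0 h1 (sqE _ bI0) hI0 -h2 nth_index.
Qed.

End LetterBijection.

(* Transposing two equal-sized values makes the block bijection match the alpha-beta-blocks. *)
Lemma block_bijection_fix (SE SF : IFS) (h : {set 'I_(N SE)} -> {set 'I_(N SF)}) I0 J0 :
  (forall I, hblock I -> hblock (h I)) ->
  (forall I J, hblock I -> hblock J -> h I = h J -> I = J) ->
  (forall J, hblock J -> exists2 I, hblock I & h I = J) ->
  (forall I, hblock I -> #|h I| = #|I|) ->
  hblock I0 -> hblock J0 -> #|I0| = #|J0| ->
  exists g : {set 'I_(N SE)} -> {set 'I_(N SF)},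
    [/\ (forall I, hblock I -> hblock (g I)),
        (forall I J, hblock I -> hblock J -> g I = g J -> I = J),
        (forall J, hblock J -> exists2 I, hblock I & g I = J),
        (forall I, hblock I -> #|g I| = #|I|) & g I0 = J0].
Proof.
move=> hb hinj hsurj hcard bI bJ cIJ.
pose sw J := if J == J0 then h I0 else if J == h I0 then J0 else J.
have swK : involutive sw.
  move=> J; rewrite /sw; case: (eqVneq J J0) => [->|n1].
    by rewrite eqxx; case: eqP => // ->.
  case: (eqVneq J (h I0)) => [->|n2]; first by rewrite eqxx.
  by rewrite (negPf n1) (negPf n2).
have swb J : hblock J -> hblock (sw J).
  by rewrite /sw; case: eqP => _; [move=> _; apply: hb|case: eqP].
exists (fun I => sw (h I)); split.
- by move=> I bI'; apply/swb/hb.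
- by move=> I J bI' bJ' /(can_inj swK); apply: hinj.
- move=> J bJ'; have [I bI' e] := hsurj _ (swb _ bJ'); exists I => //.
  by rewrite e swK.
- move=> I bI'; rewrite -(hcard I bI') /sw; case: (eqVneq (h I) J0) => [->|_].
    by rewrite hcard // cIJ.
  by case: eqP => // ->; rewrite hcard.
- by rewrite /sw eqxx; case: eqP.
Qed.

(** * From letters to codes *)

Lemma near_map (T T' P P' : Type) (V : T -> vtx -> P) (V' : T' -> vtx -> P') fx fx' (sg : T -> T') ok n a b :
  (forall t u c d, ok t -> ok u -> V c t = V d u -> V' (sg c) t = V' (sg d) u) ->
  (forall t c, ok t -> fx t c -> fx' t (sg c)) ->
  code_near V fx ok n a b -> code_near V' fx' ok n (sg \o a) (sg \o b).
Proof.
move=> hV hf; elim: n a b => [//|n IH] a b [[e h]|[t [u [ot ou e ra rb]]]]; [left|right].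
  by split; [rewrite /= e|apply: IH h].
exists t, u; split=> //; first exact: hV.
  by move=> k kn; apply: hf => //; apply: ra.
by move=> k kn; apply: hf => //; apply: rb.
Qed.

(** Between different cells, base contacts are exactly horizontal adjacencies, so with tops ignored
    a bijection of letters respecting these loses no level. *)
Lemma coarse_letters (SE SF : IFS) (GE : gasket_IFS SE) (GF : gasket_IFS SF)
    (sg : 'I_(N SE) -> 'I_(N SF)) al be al' be' :
  fixes VA al -> fixes VB be -> fixes VA al' -> fixes VB be' ->
  injective sg -> (forall y, exists x, sg x = y) ->
  (forall i j, hadj i j <-> hadj (sg i) (sg j)) -> sg al = al' -> sg be = be' ->
  coarse (code_near (@vert SE) (@fixes SE) basev) (code_near (@vert SF) (@fixes SF) basev) 0
    (fun a b => b = sg \o a).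
Proof.
move=> fA fB fA' fB' inj surj adj eA eB.
have [tau tauK] := boolp.choice surj; have sgK i : tau (sg i) = i by apply: inj; rewrite tauK.
have baseE t : basev t -> t = VA \/ t = VB by case: t; [left|right|case].
split; first by move=> a; exists (sg \o a).
- by move=> b; exists (tau \o b); apply/funext => k /=; rewrite tauK.
- move=> n a a' _ _ -> ->; apply: near_map => [t u c d|t c].
    move=> /baseE[->|->] /baseE[->|->].
    + by move=> /(vert_inj GE) ->.
    + by move=> /esym/hadj_vert/adj/hadj_vert ->.
    + by move=> /hadj_vert/adj/hadj_vert ->.
    + by move=> /(vert_inj GE) ->.
  move=> /baseE[->|->] fc.
    by rewrite (fixes_uniq GE fc fA) eA.
  by rewrite (fixes_uniq GE fc fB) eB.
- move=> n a a' _ _ -> ->; rewrite add0n => h.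
  have := @near_map _ _ _ _ _ (@vert SE) _ (@fixes SE) tau basev n (sg \o a) (sg \o a') _ _ h.
  have e c : tau \o (sg \o c) = c by apply/funext => k /=.
  rewrite !e; apply=> [t u c d|t c].
    move=> /baseE[->|->] /baseE[->|->].
    + by move=> /(vert_inj GF) ->.
    + move=> /esym/hadj_vert; rewrite -{1}(tauK c) -{1}(tauK d) => /adj/hadj_vert -> //.
    + by move=> /hadj_vert; rewrite -{1}(tauK c) -{1}(tauK d) => /adj/hadj_vert ->.
    + by move=> /(vert_inj GF) ->.
  move=> /baseE[->|->] fc.
    by rewrite (fixes_uniq GF fc fA') -eA sgK.
  by rewrite (fixes_uniq GF fc fB') -eB sgK.
Qed.

(** * Hoelder estimates *)

Lemma dist_ge0 p q : 0 <= dist p q. Proof. exact: sqrtr_ge0. Qed.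

Lemma dist_eq0 p q : dist p q <= 0 -> p = q.
Proof.
move=> h; apply: bc_inj => t; apply/eqP; rewrite -subr_eq0 -normr_le0.
by apply: le_trans (dist_ge p q t) _; rewrite pmulr_rle0.
Qed.

Lemma distxx p : dist p p = 0. Proof. by rewrite /dist !subrr expr0n addr0 sqrtr0. Qed.

Lemma code_dist (S : IFS) (GS : gasket_IFS S) (lo hi : R) : 0 < lo ->
  (forall j : 'I_(N S), lo <= ifs_ratio j) -> (forall j : 'I_(N S), ifs_ratio j <= hi) ->
  exists2 C : R, 0 < C & forall n a b x y, @code S a x -> @code S b y ->
    (code_near (@vert S) (@fixes S) anyv n a b -> dist x y <= C * hi ^+ n) /\
    (~ code_near (@vert S) (@fixes S) anyv n a b -> lo ^+ n <= C * dist x y).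
Proof.
move=> lo0 lole lehi; have [c c0 far] := code_far GS lo0 lole.
have cC : 0 < 2 / c by rewrite divr_gt0.
(* 8 is the 4 of [dist_le] times the 2 of [code_near_le]; [2 / c] combines [dist_ge] and
   [code_far]. *)
exists (8 + 2 / c); first by lra.
move=> n a b x y ax By; split=> [h|h].
  have hi0 : 0 <= hi by have := ratio_gt0 GS (a 0%N); have := lehi (a 0%N); lra.
  have := dist_le (fun t => code_near_le GS lehi t ax By h).
  have : 0 <= hi ^+ n by rewrite exprn_ge0.
  by move=> h1 h2; apply: le_trans h2 _; rewrite mulrA ler_wpM2r //; lra.
have [t ht] := far _ _ _ _ _ ax By h.
have h1 := le_trans ht (dist_ge x y t); have d0 := dist_ge0 x y.
have : lo ^+ n <= 2 / c * dist x y.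
  by rewrite mulrAC ler_pdivlMr // mulrC.
by rewrite mulrDl; lra.
Qed.

Section Hoelder.
Variables (SE SF : IFS) (lo hi : R).
Hypotheses (GE : gasket_IFS SE) (GF : gasket_IFS SF).
Hypotheses (lo0 : 0 < lo) (lohi : lo <= hi) (hi1 : hi < 1).
Hypotheses (loE : forall j : 'I_(N SE), lo <= ifs_ratio j) (hiE : forall j : 'I_(N SE), ifs_ratio j <= hi).
Hypotheses (loF : forall j : 'I_(N SF), lo <= ifs_ratio j) (hiF : forall j : 'I_(N SF), ifs_ratio j <= hi).

(** The exponent with lo^s = hi; it is 1 when the bounds coincide. *)
Let s : R := ln hi / ln lo.

Lemma hoelder_exponent_gt0 : 0 < s.
Proof.
have lo1 : lo < 1 := le_lt_trans lohi hi1; have hi0 : 0 < hi := lt_le_trans lo0 lohi.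
by rewrite /s -mulrNN -invrN divr_gt0 // oppr_gt0 ln_lt0 // ?lo0 ?hi0.
Qed.

Lemma lo_powR n : (lo ^+ n) `^ s = hi ^+ n.
Proof.
have lo1 : lo < 1 := le_lt_trans lohi hi1; have hi0 : 0 < hi := lt_le_trans lo0 lohi.
have lnlo : ln lo != 0 by rewrite lt_eqF // ln_lt0 // lo0.
have e : lo `^ s = hi by rewrite /powR gt_eqF // /s divfK // lnK // posrE.
by rewrite -powR_mulrn ?ltW // -powRrM mulrC powRrM e powR_mulrn // ltW.
Qed.

(** If [n] is the last level of nearness, the source distance is at least of order lo^(n+1) and the
    target distance at most of order hi^(n-m); the exponent [s] compares them. *)
Lemma coarse_hoelder m (M : (nat -> 'I_(N SE)) -> (nat -> 'I_(N SF)) -> Prop) :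
  (forall n a a' b b', M a b -> M a' b' ->
     code_near (@vert SE) (@fixes SE) anyv (m + n)%N a a' -> code_near (@vert SF) (@fixes SF) anyv n b b') ->
  exists2 C : R, 0 < C & forall a a' b b' x x' y y', M a b -> M a' b' ->
    code a x -> code a' x' -> code b y -> code b' y' -> dist y y' <= C * dist x x' `^ s.
Proof.
move=> hM; have hi0 : 0 < hi := lt_le_trans lo0 lohi.
have [CE CE0 PE] := code_dist GE lo0 loE hiE; have [CF CF0 PF] := code_dist GF lo0 loF hiF.
have hm0 : 0 < hi ^+ m.+1 by rewrite exprn_gt0.
exists (CF / hi ^+ m.+1 * CE `^ s); first by rewrite mulr_gt0 ?powR_gt0 // divr_gt0.
move=> a a' b b' x x' y y' mab mab' ax ax' By By'.
set D := dist x x'; set D' := dist y y'; have d0 : 0 <= D by exact: dist_ge0.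
(* For [k < m] the truncated difference is level 0, where all codes are near. *)
have near_le k : code_near (@vert SE) (@fixes SE) anyv k a a' -> D' <= CF * hi ^+ (k - m).
  move=> h; apply: (proj1 (PF _ _ _ _ _ By By')).
  have [mk|km] := leqP m k; first by apply: (hM _ _ _ _ _ mab mab'); rewrite subnKC.
  by rewrite (_ : (k - m)%N = 0%N) //; apply/eqP; rewrite subn_eq0 ltnW.
have [al|/existsNP ex] := pselect (forall k, code_near (@vert SE) (@fixes SE) anyv k a a').
  have D'0 : D' <= 0.
    rewrite leNgt; apply/negP => lt; have [||k hk] := @expr_small hi (D' / CF).
    - by rewrite ltW.
    - by rewrite divr_gt0.
    have := near_le (k + m)%N (al _); rewrite addnK => h.
    by move: hk; rewrite ltr_pdivlMr // mulrC ltNge h.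
  apply: le_trans D'0 _; rewrite mulr_ge0 ?powR_ge0 //.
  by rewrite mulr_ge0 ?powR_ge0 // divr_ge0 // ltW.
have {}ex : exists k, `[< ~ code_near (@vert SE) (@fixes SE) anyv k a a' >].
  by case: ex => k hk; exists k; apply/asboolP.
case: (ex_minnP ex) => -[/asboolP[] //|n] /asboolP nn nmin.
have nearn : code_near (@vert SE) (@fixes SE) anyv n a a'.
  by apply: contrapT => h; have := nmin n (asboolT h); rewrite ltnn.
have h1 := proj2 (PE _ _ _ _ _ ax ax') nn; have h2 := near_le n nearn.
have h3 : hi ^+ (n - m) <= hi ^+ n.+1 / hi ^+ m.+1.
  by rewrite ler_pdivlMr // -exprD; apply: ler_wiXn2l; [exact: ltW|exact: ltW|lia].
have h4 : hi ^+ n.+1 <= CE `^ s * D `^ s.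
  rewrite -lo_powR -powRM ?(ltW CE0) //; apply: ge0_ler_powR => //; rewrite ?nnegrE.
  - exact: ltW hoelder_exponent_gt0.
  - by rewrite exprn_ge0 // ltW.
  - by rewrite mulr_ge0 // ltW.
apply: le_trans h2 _.
have h5 : hi ^+ (n - m) <= CE `^ s * D `^ s / hi ^+ m.+1.
  by apply: le_trans h3 _; rewrite ler_wpM2r // invr_ge0 ltW.
apply: le_trans (_ : CF * (CE `^ s * D `^ s / hi ^+ m.+1) <= _).
  by rewrite ler_wpM2l // ltW.
by rewrite le_eqVlt; apply/orP; left; apply/eqP; ring.
Qed.

End Hoelder.

(** A point may have several codes. The two estimates show that [rel] nevertheless relates each
    point to only one, in both directions. *)
Lemma bi_holder_of_coarse (SE SF : IFS) (E F : set pt) (lo hi : R) m M :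
  fractal_gasket SE E -> fractal_gasket SF F ->
  0 < lo -> lo <= hi -> hi < 1 ->
  (forall j : 'I_(N SE), lo <= ifs_ratio j <= hi) -> (forall j : 'I_(N SF), lo <= ifs_ratio j <= hi) ->
  coarse (code_near (@vert SE) (@fixes SE) anyv) (code_near (@vert SF) (@fixes SF) anyv) m M ->
  exists f C, bi_holder_map E F f (ln hi / ln lo) C.
Proof.
move=> [GE AE] [GF AF] lo0 lohi hi1 rE rF [tot onto fwd bwd].
have loE j : lo <= ifs_ratio (i := SE) j by case/andP: (rE j).
have hiE j : ifs_ratio (i := SE) j <= hi by case/andP: (rE j).
have loF j : lo <= ifs_ratio (i := SF) j by case/andP: (rF j).
have hiF j : ifs_ratio (i := SF) j <= hi by case/andP: (rF j).
have s0 := hoelder_exponent_gt0 lo0 lohi hi1; set s := ln hi / ln lo in s0 *.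
have [C1 C10 H1] := coarse_hoelder GE GF lo0 lohi hi1 loE hiE loF hiF fwd.
have [C2 C20 H2] := @coarse_hoelder SF SE lo hi GF GE lo0 lohi hi1 loF hiF loE hiE m (fun b a => M a b)
  (fun n b b' a a' => @bwd n a a' b b').
rewrite -/s in H1 H2.
pose rel x y := F y /\ exists a b, [/\ M a b, code a x & code b y].
have h1 x x' y y' : rel x y -> rel x' y' -> dist y y' <= C1 * dist x x' `^ s.
  by move=> [_ [a [b [mab ax By]]]] [_ [a' [b' [mab' ax' By']]]]; apply: H1 mab mab' ax ax' By By'.
have h2 x x' y y' : rel x y -> rel x' y' -> dist x x' <= C2 * dist y y' `^ s.
  by move=> [_ [a [b [mab ax By]]]] [_ [a' [b' [mab' ax' By']]]]; apply: H2 mab mab' By By' ax ax'.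
have ex x : exists y, E x -> rel x y.
  have [Ex|nE] := pselect (E x); last by exists x.
  have [a ax] := code_of_point GE hi1 hiE AE Ex; have [b mab] := tot a.
  by have [y Fy By] := point_of_code GF hi1 hiF AF b; exists y => _; split=> //; exists a, b.
have [f fP] := boolp.choice ex.
have pow0 : 0 `^ s = 0 :> R by apply: powR0; rewrite gt_eqF.
(* [C1] serves the upper bound; the estimate for the inverse, raised to the power 1/s, gives the
   other term. *)
exists f, (C1 + C2 `^ s^-1).
have P2 : 0 < C2 `^ s^-1 by rewrite powR_gt0.
split=> //; last 1 first.
- move=> x y Ex Ey; have d0 := dist_ge0 x y; have d0' := dist_ge0 (f x) (f y); split.
    have h := h2 _ _ _ _ (fP x Ex) (fP y Ey).
    have : dist x y `^ s^-1 <= C2 `^ s^-1 * dist (f x) (f y).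
      rewrite -[X in _ * X](powRr1 d0') -(mulfV (lt0r_neq0 s0)) powRrM -powRM ?powR_ge0 ?(ltW C20) //.
      apply: ge0_ler_powR => //; rewrite ?nnegrE ?invr_ge0 ?(ltW s0) //.
      by rewrite mulr_ge0 ?powR_ge0 // ltW.
    move=> h'; rewrite mulrC ler_pdivrMr; last by rewrite addr_gt0.
    by apply: le_trans h' _; rewrite mulrC ler_wpM2l // lerDr ltW.
  apply: le_trans (h1 _ _ _ _ (fP x Ex) (fP y Ey)) _.
  by rewrite ler_wpM2r ?powR_ge0 // lerDl ltW.
- move=> x y /set_mem Ex /set_mem Ey e; apply: dist_eq0.
  by have := h2 _ _ _ _ (fP x Ex) (fP y Ey); rewrite e distxx pow0 mulr0.
- apply/seteqP; split=> [_ [x Ex <-]|y Fy]; first by case: (fP x Ex).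
  have [b By] := code_of_point GF hi1 hiF AF Fy; have [a mab] := onto b.
  have [x Ex ax] := point_of_code GE hi1 hiE AE a; exists x => //; apply: dist_eq0.
  have rxy : rel x y by split=> //; exists a, b.
  by have := h1 _ _ _ _ (fP x Ex) rxy; rewrite distxx pow0 mulr0.
- by rewrite addr_gt0.
Qed.

Lemma ratio_bounds (SE SF : IFS) : gasket_IFS SE -> gasket_IFS SF ->
  exists lo hi : R, [/\ 0 < lo, lo <= hi, hi < 1, (forall j : 'I_(N SE), lo <= ifs_ratio j <= hi) &
    (forall j : 'I_(N SF), lo <= ifs_ratio j <= hi)].
Proof.
move=> GE GF.
have [c c0 cE] := fin_min (ratio_gt0 GE); have [d d0 dF] := fin_min (ratio_gt0 GF).
have h (S : IFS) (G : gasket_IFS S) (x : 'I_(N S)) : 0 < 1 - ifs_ratio x by rewrite subr_gt0 ratio_lt1.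
have [e e0 eE] := fin_min (h SE GE); have [g g0 gF] := fin_min (h SF GF).
(* The common value 1/2 ensures [lo <= hi]. *)
pose lo : R := Num.min (1 / 2) (Num.min c d); pose hi : R := Num.max (1 / 2) (1 - Num.min e g).
have l1 : lo <= c by rewrite /lo !ge_min lexx !orbT.
have l2 : lo <= d by rewrite /lo !ge_min lexx !orbT.
have l3 : lo <= 1 / 2 by rewrite /lo !ge_min lexx.
have h1 : 1 / 2 <= hi by rewrite /hi le_max lexx.
have h2 : 1 - Num.min e g <= hi by rewrite /hi le_max lexx orbT.
have m1 : Num.min e g <= e by rewrite ge_min lexx.
have m2 : Num.min e g <= g by rewrite ge_min lexx orbT.
have m0 : 0 < Num.min e g by rewrite lt_min e0.
exists lo, hi; split.
- by rewrite !lt_min c0 d0 divr_gt0.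
- lra.
- by rewrite /hi gt_max; apply/andP; split; lra.
- by move=> j; have := cE j; have := eE j => a b; apply/andP; split; lra.
- by move=> j; have := dF j; have := gF j => a b; apply/andP; split; lra.
Qed.

Theorem theorem1p4 (SE SF : IFS) (E F : set pt) :
  in_FTab SE E -> in_FTab SF F ->
  (* size-preserving bijection between the collections of horizontal blocks *)
  (exists h : {set 'I_(N SE)} -> {set 'I_(N SF)},
      [/\ (forall I : {set 'I_(N SE)}, hblock I -> hblock (h I)),
          (forall I J : {set 'I_(N SE)}, hblock I -> hblock J -> h I = h J -> I = J),
          (forall J : {set 'I_(N SF)}, hblock J -> exists2 I, hblock I & h I = J) &
          (forall I : {set 'I_(N SE)}, hblock I -> #|h I| = #|I|)]) ->
  (* the alpha-beta-blocks of E and F have the same size *)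
  (forall (IE : {set 'I_(N SE)}) (aE bE : 'I_(N SE)) (IF : {set 'I_(N SF)}) (aF bF : 'I_(N SF)),
      hblock IE -> is_alpha E aE -> is_beta E bE -> aE \in IE -> bE \in IE ->
      hblock IF -> is_alpha F aF -> is_beta F bF -> aF \in IF -> bF \in IF ->
      #|IE| = #|IF|) ->
  (exists f s C, bi_holder_map E F f s C) /\
  ((exists r : R, (forall j : 'I_(N SE), ifs_ratio j = r) /\ (forall j : 'I_(N SF), ifs_ratio j = r)) ->
     exists f C, bi_holder_map E F f 1 C).
Proof.
move=> [gE topE [IE [aE [bE [bIE alE beE aIE bIE']]]]] [gF topF [IF [aF [bF [bIF alF beF aIF bIF']]]]].
move=> [h [hb hinj hsurj hcard]] hsize.
have cI := hsize _ _ _ _ _ _ bIE alE beE aIE bIE' bIF alF beF aIF bIF'.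
have [g [gb ginj gsurj gcard gI]] := block_bijection_fix hb hinj hsurj hcard bIE bIF cI.
have [GE AE] := gE; have [GF AF] := gF.
have [_ fAE] := alE; have [_ fBE] := beE; have [_ fAF] := alF; have [_ fBF] := beF.
have [sg [sginj sgsurj sgadj sgA sgB]] := letter_bijection GE GF gb ginj gsurj gcard
  bIE aIE bIE' bIF aIF bIF' gI fAE fBE fAF fBF.
have [lo [hi [lo0 lohi hi1 rE rF]]] := ratio_bounds GE GF.
have bd (S : IFS) : (forall j : 'I_(N S), lo <= ifs_ratio j <= hi) -> forall j : 'I_(N S), ifs_ratio j <= hi.
  by move=> r j; case/andP: (r j).
have [m1 [M1 c1]] := gasket_coarse GE hi1 (bd _ rE) AE fAE fBE topE.
have [m2 [M2 c2]] := gasket_coarse GF hi1 (bd _ rF) AF fAF fBF topF.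
have c0 := coarse_letters GE GF fAE fBE fAF fBF sginj sgsurj sgadj sgA sgB.
(* Detach the tops of [E], rename the letters, and attach the tops of [F]. *)
have c := coarse_comp (coarse_comp c1 c0) (coarse_inv c2).
split.
  have [f [C fC]] := bi_holder_of_coarse gE gF lo0 lohi hi1 rE rF c.
  by exists f, (ln hi / ln lo), C.
move=> [r [rE' rF']].
have r0 : 0 < r by rewrite -(rE' aE) ratio_gt0.
have r1 : r < 1 by rewrite -(rE' aE) ratio_lt1.
(* The same correspondence with both bounds equal to [r] gives exponent [ln r / ln r]. *)
have [||f [C fC]] := bi_holder_of_coarse gE gF r0 (lexx r) r1 _ _ c.
- by move=> j; rewrite rE' lexx.
- by move=> j; rewrite rF' lexx.
exists f, C; move: fC; rewrite divff // lt_eqF // ln_lt0 // r0.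
by [].
Qed.
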